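(* Let $\phi:\mathbb{C}_0\to\mathbb{C}_0$ be a non-constant analytic function of the form $\phi(s)=c_0 s+\varphi(s)$ with $c_0\in\mathbb{N}_0$ and $\varphi\in\mathcal{D}$, and suppose that $C_\phi f=f\circ\phi$ belongs to $\mathcal{A}^+$ for every $f\in\mathcal{A}^+$, so that $C_\phi:\mathcal{A}^+\to\mathcal{A}^+$ is a composition operator. Then $C_\phi$ is an automorphism of $\mathcal{A}^+$ (i.e. a bijective algebra homomorphism of $\mathcal{A}^+$ onto itself) if and only if $\phi$ is a vertical translation: $\phi(s)=s+i\tau$ for some real number $\tau$.
   Context: For $\theta\in\mathbb{R}$, $\mathbb{C}_\theta=\{s\in\mathbb{C}:\operatorname{Re}s>\theta\}$. The Wiener–Dirichlet algebra $\mathcal{A}^+$ is the set of functions $f(s)=\sum_{n\ge1}a_n n^{-s}$ with $\|f\|_{\mathcal{A}^+}=\sum_{n\ge1}|a_n|<\infty$, viewed as functions on $\{\operatorname{Re}s\ge0\}$ (where the series converge absolutely); it is a commutative unital Banach algebra under pointwise multiplication (Dirichlet convolution of coefficients: $c_n=\sum_{ij=n}a_ib_j$). $\mathcal{D}$ denotes the space of analytic functions $\mathbb{C}_0\to\mathbb{C}$ which are representable by a convergent Dirichlet series $\sum_{n\ge1}c_n n^{-s}$ for $\operatorname{Re}s$ large enough. $\mathbb{N}_0=\{0,1,2,\dots\}$. *)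

(* Defs.v *)
From Stdlib Require Import Reals.
From Coquelicot Require Import Coquelicot.
Open Scope R_scope.

Definition cexp (z : C) : C :=
  (exp (Re z) * cos (Im z), exp (Re z) * sin (Im z)).

Definition npow_neg (n : nat) (s : C) : C :=
  cexp (Cmult (RtoC (- ln (INR n))) s).

Definition dterm (a : nat -> C) (s : C) (n : nat) : C :=
  match n with O => RtoC 0 | S _ => Cmult (a n) (npow_neg n s) end.

Definition abs_summable (a : nat -> C) : Prop :=
  ex_series (fun n => match n with O => 0 | S _ => Cmod (a n) end).

Definition in_Aplus (f : C -> C) : Prop :=
  exists a : nat -> C, abs_summable a /\
    forall s : C, 0 <= Re s -> is_series (dterm a s) (f s).

(* g : C_0 -> C belongs to A^+ (restricted to C_0): it is given on C_0 by an
   absolutely convergent Dirichlet series (which then extends uniquely to Re s >= 0) *)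
Definition in_Aplus_on_C0 (g : C -> C) : Prop :=
  exists a : nat -> C, abs_summable a /\
    forall s : C, 0 < Re s -> is_series (dterm a s) (g s).

Definition holomorphic_C0 (f : C -> C) : Prop :=
  forall s : C, 0 < Re s -> @ex_derive C_AbsRing C_NormedModule f s.

Definition in_D (f : C -> C) : Prop :=
  holomorphic_C0 f /\
  exists (c : nat -> C) (theta : R),
    forall s : C, theta < Re s -> is_series (dterm c s) (f s).

(* C_phi : A^+ -> A^+ (given that it maps A^+ to A^+), f |-> f o phi,
   is an automorphism: an algebra homomorphism (automatic, since composition is
   pointwise: (fg) o phi = (f o phi)(g o phi), 1 o phi = 1, linearity) which is
   bijective. Elements of A^+ are identified with their values on C_0 (these
   determine the coefficients). *)
Definition Cphi_bijective (phi : C -> C) : Prop :=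
  (forall f g : C -> C, in_Aplus f -> in_Aplus g ->
     (forall s : C, 0 < Re s -> f (phi s) = g (phi s)) ->
     forall s : C, 0 <= Re s -> f s = g s)
  /\
  (forall g : C -> C, in_Aplus g ->
     exists f : C -> C, in_Aplus f /\
       forall s : C, 0 < Re s -> f (phi s) = g s).

(* Main.v *)
Require Import Defs.
From Stdlib Require Import Reals Lra Lia Arith List.
From Coquelicot Require Import Coquelicot.
Import ListNotations.
Open Scope R_scope.

(** Let [f] be the preimage of [2^(-s)] under [C_phi], and write [f = sum a_n n^(-s)]
    and [2^(-phi) = sum b_n n^(-s)].  Then [|2^(-phi)| <= 1], and also [|f| <= 1],
    because [1 - 2^(-s)/lambda] is invertible in A^+ when [|lambda| > 1].  Comparing
    the growth of both sides of [f (phi s) = 2^(-s)] as [Re s] tends to infinity rules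
    out [c0 >= 2], and for [c0 = 1] it gives [a_1 = b_1 = 0] and [a_2 b_2 = 1].  A
    Dirichlet series bounded by 1 satisfies [|b_2| + |b_m|/2 <= 1], as shown by
    averaging over [Im s] against the nonnegative kernel [1 + cos]; hence [|b_2| = 1],
    all other [b_m] vanish, and [2^(-phi) = b_2 2^(-s)].

    If [c0 = 0] then [phi] tends to a point [c1] with [Re c1 > 0], and
    [phi - c1 = c 2^(-s) + O(3^(-s))].  Second order Taylor expansions at [c1] of the
    preimages of [2^(-s)] and of [3^(-s)] are incompatible with this. *)

(** * Complex series *)

(** The relation [f (phi s) = 2^(-s)] controls [f] only on the image of [phi], while the coefficient
    inequality needs a bound on a whole half-plane; this is why invertibility in A^+ enters. Once
    [|a_2| <= 1] and [|b_2| <= 1] are known, [a_2 b_2 = 1] forces equality. The kernel [1 + cos]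
    carries three frequencies, so besides [b_2] and [b_m] the index [4/m] is picked up; for [m > 2]
    it is an integer only if [m = 4], and then [b_1 = 0] removes it. The series of [2^(-phi)] is
    valid on all of C_0, so the vanishing of its coefficients gives the identity there directly,
    with no analytic continuation. For [c0 = 0], the same inequality around [b_1] shows that a limit
    with [Re c1 = 0] would make [phi] constant. The limit must be interior because an element of A^+
    need not be differentiable on the boundary line. The contradiction then rests on the Taylor
    error having size [4^(-s)], which is negligible against [3^(-s)]. *)

Lemma is_series_C_eps (u : nat -> C) (l : C) :
  is_series u l <->
  forall eps : R, 0 < eps ->
    exists N, forall n, (N <= n)%nat -> Cmod (sum_n u n - l) < eps.
Proof.
  split.
  - intros H eps He.
    assert (Hb := proj1 (filterlim_locally_ball_norm (sum_n u) l) H (mkposreal eps He)).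
    destruct Hb as [N HN]; exists N; intros n Hn; exact (HN n Hn).
  - intros H. apply (filterlim_locally_ball_norm (sum_n u) l).
    intros eps. destruct (H eps (cond_pos eps)) as [N HN].
    exists N; intros n Hn; exact (HN n Hn).
Qed.

Lemma Cmod_sum_n_le (u : nat -> C) (b : nat -> R) (n : nat) :
  (forall k, (k <= n)%nat -> Cmod (u k) <= b k) -> Cmod (sum_n u n) <= sum_n b n.
Proof.
  induction n as [|n IH]; intros H.
  - rewrite !sum_O; auto.
  - rewrite !sum_Sn. eapply Rle_trans; [apply Cmod_triangle|].
    apply Rplus_le_compat; auto.
Qed.

Lemma is_series_C_bound (u : nat -> C) (l : C) (B : R) :
  is_series u l -> (forall n, Cmod (sum_n u n) <= B) -> Cmod l <= B.
Proof.
  intros H HB. apply Rnot_lt_le; intros Hlt.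
  destruct (proj1 (is_series_C_eps u l) H (Cmod l - B)) as [N HN]; [lra|].
  specialize (HN N (le_n _)); specialize (HB N).
  assert (T := Cmod_triangle (sum_n u N) (l - sum_n u N)).
  replace (sum_n u N + (l - sum_n u N))%C with l in T by ring.
  rewrite <- Cmod_opp in HN.
  replace (- (sum_n u N - l))%C with (l - sum_n u N)%C in HN by ring. lra.
Qed.

Lemma is_series_C_unique (u : nat -> C) (l l' : C) :
  is_series u l -> is_series u l' -> l = l'.
Proof.
  intros H H'.
  assert (E : Cmod (l - l') <= 0).
  { apply (is_series_C_bound (fun n => u n - u n)%C).
    - exact (is_series_minus u u l l' H H').
    - intros n. replace (sum_n (fun n => u n - u n)%C n) with (RtoC 0).
      + rewrite Cmod_0; lra.
      + symmetry. induction n as [|n IH].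
        * rewrite sum_O; ring.
        * rewrite sum_Sn, IH. change (0 + (u (S n) - u (S n)) = 0)%C. ring. }
  assert (Z : (l - l')%C = 0%C).
  { apply Cmod_eq_0. apply Rle_antisym; [exact E | apply Cmod_ge_0]. }
  replace l with ((l - l') + l')%C by ring. rewrite Z. ring.
Qed.

Lemma is_series_C_ext (u v : nat -> C) (l : C) :
  (forall n, u n = v n) -> is_series u l -> is_series v l.
Proof. apply (is_series_ext u v l). Qed.

Lemma is_series_C_plus (u v : nat -> C) (l m : C) :
  is_series u l -> is_series v m -> is_series (fun n => u n + v n)%C (l + m)%C.
Proof. exact (is_series_plus u v l m). Qed.

Lemma is_series_C_minus (u v : nat -> C) (l m : C) :
  is_series u l -> is_series v m -> is_series (fun n => u n - v n)%C (l - m)%C.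
Proof. exact (is_series_minus u v l m). Qed.

Lemma is_series_C_scal (c : C) (u : nat -> C) (l : C) :
  is_series u l -> is_series (fun n => c * u n)%C (c * l)%C.
Proof. exact (is_series_scal c u l). Qed.

Lemma sum_n_single (p : nat) (c : C) (n : nat) :
  sum_n (fun k => if Nat.eqb k p then c else RtoC 0) n = if Nat.leb p n then c else RtoC 0.
Proof.
  induction n as [|n IH].
  - rewrite sum_O. destruct p; reflexivity.
  - rewrite sum_Sn, IH.
    destruct (Nat.eqb_spec (S n) p), (Nat.leb_spec p n), (Nat.leb_spec p (S n)); try lia;
      match goal with |- plus ?a ?b = ?c => change (a + b = c)%C end; ring.
Qed.

Lemma is_series_C_single (p : nat) (c : C) :
  is_series (fun k => if Nat.eqb k p then c else RtoC 0) c.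
Proof.
  apply is_series_C_eps; intros eps He; exists p; intros n Hn.
  rewrite sum_n_single. destruct (Nat.leb_spec p n); [|lia].
  replace (c - c)%C with (RtoC 0) by ring. rewrite Cmod_0; lra.
Qed.

Lemma sum_n_le_Series (D : nat -> R) (n : nat) :
  (forall k, 0 <= D k) -> ex_series D -> sum_n D n <= Series D.
Proof.
  intros HD Hs. apply (is_lim_seq_incr_compare (sum_n D) (Series D)).
  - exact (Series_correct D Hs).
  - intros k. rewrite sum_Sn. change (sum_n D k <= sum_n D k + D (S k)).
    specialize (HD (S k)); lra.
Qed.

Lemma ex_series_bounded (D : nat -> R) (B : R) :
  (forall k, 0 <= D k) -> (forall n, sum_n D n <= B) -> ex_series D.
Proof.
  intros HD HB. destruct (ex_finite_lim_seq_incr (sum_n D) B) as [l Hl]; auto.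
  - intros n. rewrite sum_Sn. change (sum_n D n <= sum_n D n + D (S n)).
    specialize (HD (S n)); lra.
  - exists l; exact Hl.
Qed.

Lemma Series_nonneg (D : nat -> R) :
  (forall k, 0 <= D k) -> ex_series D -> 0 <= Series D.
Proof.
  intros HD Hs. eapply Rle_trans; [|apply (sum_n_le_Series D 0 HD Hs)].
  rewrite sum_O; auto.
Qed.

Lemma series_tail_small (D : nat -> R) (eps : R) :
  (forall k, 0 <= D k) -> ex_series D -> 0 < eps ->
  exists K, forall n, sum_n (fun k => if Nat.ltb k K then 0 else D k) n <= eps.
Proof.
  intros HD Hs He.
  assert (L : is_lim_seq (sum_n D) (Series D)) by exact (Series_correct D Hs).
  apply is_lim_seq_spec in L. destruct (L (mkposreal eps He)) as [N HN].
  specialize (HN N (le_n _)); simpl in HN.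
  exists (S N).
  set (D' := fun k => if Nat.ltb k (S N) then 0 else D k).
  assert (H0 : forall n, (n <= N)%nat -> (sum_n D' n : R) = 0).
  { induction n as [|n IH]; intros Hn.
    - rewrite sum_O; unfold D'; reflexivity.
    - rewrite sum_Sn, IH by lia. unfold D'.
      destruct (Nat.ltb_spec (S n) (S N)); [|lia]. apply Rplus_0_l. }
  assert (H1 : forall j, (sum_n D' (N + j) : R) = sum_n D (N + j) - sum_n D N).
  { induction j as [|j IH].
    - rewrite Nat.add_0_r, H0 by lia. ring.
    - rewrite Nat.add_succ_r, !sum_Sn, IH. unfold D'.
      destruct (Nat.ltb_spec (S (N + j)) (S N)); [lia|].
      unfold plus; simpl; ring. }
  intros n. destruct (le_lt_dec n N) as [Hn|Hn].
  - rewrite H0; auto; lra.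
  - replace n with (N + (n - N))%nat by lia. rewrite H1.
    assert (sum_n D (N + (n - N)) <= Series D) by (apply sum_n_le_Series; auto).
    apply Rabs_def2 in HN. lra.
Qed.

Lemma sum_n_Rle (a b : nat -> R) (n : nat) :
  (forall k, a k <= b k) -> sum_n a n <= sum_n b n.
Proof.
  intros H. induction n as [|n IH].
  - rewrite !sum_O; auto.
  - rewrite !sum_Sn. apply Rplus_le_compat; auto.
Qed.

Lemma sum_n_Rlin (a b : nat -> R) (x y : R) (n : nat) :
  sum_n (fun k => x * a k + y * b k) n = x * sum_n a n + y * sum_n b n.
Proof.
  induction n as [|n IH].
  - rewrite !sum_O; auto.
  - rewrite !sum_Sn, IH. unfold plus; simpl; ring.
Qed.

(* A quantitative form of dominated convergence: [K] depends only on the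
   dominating series and on [eps], not on the series [w]. *)
Lemma series_split_bound (D : nat -> R) (eps : R) :
  (forall k, 0 <= D k) -> ex_series D -> 0 < eps ->
  exists K, forall (w : nat -> C) (l : C) (delta M : R),
    0 <= delta -> 0 <= M -> is_series w l ->
    (forall n, (K <= n)%nat -> Cmod (w n) <= M * D n) ->
    (forall n, (n < K)%nat -> Cmod (w n) <= delta * D n) ->
    Cmod l <= delta * Series D + M * eps.
Proof.
  intros HD Hs He. destruct (series_tail_small D eps HD Hs He) as [K HK].
  exists K; intros w l delta M Hd HM Hw Hge Hlt.
  apply (is_series_C_bound w); auto. intros n.
  eapply Rle_trans; [apply (Cmod_sum_n_le w
    (fun k => delta * D k + M * (if Nat.ltb k K then 0 else D k)))|].
  - intros k _. destruct (Nat.ltb_spec k K) as [H|H].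
    + specialize (Hlt k H); lra.
    + specialize (Hge k H). assert (0 <= delta * D k) by (apply Rmult_le_pos; auto). lra.
  - rewrite sum_n_Rlin. apply Rplus_le_compat; apply Rmult_le_compat_l; auto.
    apply sum_n_le_Series; auto.
Qed.

Lemma is_series_C_Cmod_le (w : nat -> C) (l : C) (D : nat -> R) :
  is_series w l -> ex_series D -> (forall n, Cmod (w n) <= D n) -> Cmod l <= Series D.
Proof.
  intros Hw Hs HD.
  assert (HD0 : forall k, 0 <= D k) by
    (intros k; eapply Rle_trans; [apply Cmod_ge_0|apply HD]).
  apply (is_series_C_bound w); auto. intros n.
  eapply Rle_trans; [apply (Cmod_sum_n_le w D)|]; auto.
  apply sum_n_le_Series; auto.
Qed.

Lemma ex_series_C_abs (w : nat -> C) (D : nat -> R) :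
  ex_series D -> (forall n, Cmod (w n) <= D n) -> exists l : C, is_series w l.
Proof.
  intros Hs HD.
  exact (@ex_series_le C_AbsRing C_CompleteNormedModule w D HD Hs).
Qed.

(** * The complex exponential and the functions n^(-s) *)

Lemma cexp_plus (z w : C) : cexp (z + w) = (cexp z * cexp w)%C.
Proof.
  destruct z as [x y], w as [x' y']. unfold cexp, Cmult; simpl.
  rewrite exp_plus, cos_plus, sin_plus. f_equal; ring.
Qed.

Lemma cexp_0 : cexp 0 = 1%C.
Proof.
  unfold cexp; simpl. rewrite exp_0, cos_0, sin_0. unfold RtoC. f_equal; ring.
Qed.

Lemma Cmod_cexp (z : C) : Cmod (cexp z) = exp (Re z).
Proof.
  unfold Cmod, cexp; simpl.
  replace (exp (Re z) * cos (Im z) * (exp (Re z) * cos (Im z) * 1) +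
     exp (Re z) * sin (Im z) * (exp (Re z) * sin (Im z) * 1))
   with (exp (Re z) * exp (Re z) * (Rsqr (sin (Im z)) + Rsqr (cos (Im z))))
    by (unfold Rsqr; ring).
  rewrite sin2_cos2, Rmult_1_r. apply sqrt_square. left; apply exp_pos.
Qed.

Lemma cexp_neq_0 (z : C) : cexp z <> 0%C.
Proof.
  intros H. assert (E := Cmod_cexp z). rewrite H, Cmod_0 in E.
  generalize (exp_pos (Re z)); lra.
Qed.

Lemma npow_neg_plus (n : nat) (s t : C) :
  npow_neg n (s + t) = (npow_neg n s * npow_neg n t)%C.
Proof. unfold npow_neg. rewrite <- cexp_plus. f_equal. ring. Qed.

Lemma npow_neg_mult (n m : nat) (s : C) :
  (0 < n)%nat -> (0 < m)%nat -> npow_neg (n * m) s = (npow_neg n s * npow_neg m s)%C.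
Proof.
  intros Hn Hm. unfold npow_neg. rewrite <- cexp_plus. f_equal.
  rewrite mult_INR, ln_mult by (apply lt_0_INR; auto).
  rewrite !RtoC_opp, RtoC_plus. ring.
Qed.

Lemma Cmod_npow_neg (n : nat) (s : C) : Cmod (npow_neg n s) = exp (- ln (INR n) * Re s).
Proof.
  unfold npow_neg. rewrite Cmod_cexp. f_equal. destruct s; simpl; ring.
Qed.

Lemma npow_neg_1 (s : C) : npow_neg 1 s = 1%C.
Proof.
  unfold npow_neg. simpl. rewrite ln_1, Ropp_0, Cmult_0_l. apply cexp_0.
Qed.

(** Index 0 is covered by the default value [ln 0 = 0]. *)
Lemma ln_INR_nonneg (n : nat) : 0 <= ln (INR n).
Proof.
  destruct n as [|n].
  - simpl. unfold ln. destruct (Rlt_dec 0 0); [exfalso; lra | apply Rle_refl].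
  - rewrite <- ln_1. apply ln_le; [lra|]. replace 1 with (INR 1) by reflexivity. apply le_INR; lia.
Qed.

Lemma ln_INR_le (n m : nat) : (0 < n)%nat -> (n <= m)%nat -> ln (INR n) <= ln (INR m).
Proof. intros H H'. apply ln_le; [apply lt_0_INR; auto | apply le_INR; auto]. Qed.

Lemma exp_le_compat (x y : R) : x <= y -> exp x <= exp y.
Proof. intros [H| ->]; [left; apply exp_increasing; auto | right; auto]. Qed.

Lemma Cmod_npow_neg_le_1 (n : nat) (s : C) : 0 <= Re s -> Cmod (npow_neg n s) <= 1.
Proof.
  intros H. rewrite Cmod_npow_neg, <- exp_0. apply exp_le_compat.
  assert (0 <= ln (INR n) * Re s) by (apply Rmult_le_pos; auto; apply ln_INR_nonneg). lra.
Qed.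

(** * Absolutely convergent Dirichlet series *)

Definition coef_abs (a : nat -> C) (n : nat) : R :=
  match n with O => 0 | S _ => Cmod (a n) end.

Lemma coef_abs_nonneg (a : nat -> C) (n : nat) : 0 <= coef_abs a n.
Proof. destruct n; simpl; [lra | apply Cmod_ge_0]. Qed.

Lemma Cmod_dterm (a : nat -> C) (s : C) (n : nat) :
  Cmod (dterm a s n) = coef_abs a n * exp (- ln (INR n) * Re s).
Proof.
  destruct n; simpl dterm.
  - rewrite Cmod_0; simpl; ring.
  - rewrite Cmod_mult, Cmod_npow_neg. reflexivity.
Qed.

Lemma Cmod_dterm_le (a : nat -> C) (s : C) (n : nat) :
  0 <= Re s -> Cmod (dterm a s n) <= coef_abs a n.
Proof.
  intros H. rewrite Cmod_dterm, <- Cmod_npow_neg.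
  rewrite <- (Rmult_1_r (coef_abs a n)) at 2.
  apply Rmult_le_compat_l; [apply coef_abs_nonneg | apply Cmod_npow_neg_le_1; auto].
Qed.

Lemma dterm_converges (a : nat -> C) (s : C) :
  abs_summable a -> 0 <= Re s -> exists l : C, is_series (dterm a s) l.
Proof.
  intros Ha Hs. apply (ex_series_C_abs _ (coef_abs a)); auto.
  intros n; apply Cmod_dterm_le; auto.
Qed.

Lemma sum_n_trunc (u : nat -> C) (N n : nat) :
  (N <= n)%nat ->
  sum_n (fun k => if Nat.leb k N then u k else RtoC 0) n = sum_n u N.
Proof.
  induction 1 as [|n Hn IH].
  - apply sum_n_ext_loc. intros k Hk. destruct (Nat.leb_spec k N); [auto|lia].
  - rewrite sum_Sn, IH. destruct (Nat.leb_spec (S n) N); [lia|].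
    apply (plus_zero_r (sum_n u N)).
Qed.

Lemma is_series_C_trunc (u : nat -> C) (N : nat) :
  is_series (fun k => if Nat.leb k N then u k else RtoC 0) (sum_n u N : C).
Proof.
  apply is_series_C_eps; intros eps He; exists N; intros n Hn.
  rewrite sum_n_trunc by auto.
  replace (sum_n u N - sum_n u N)%C with (RtoC 0) by ring. rewrite Cmod_0; auto.
Qed.

(** Every discarded index is at least [N + 1], so the factor [(N+1)^(-Re s)] comes out of the whole
    tail. *)
Lemma dirichlet_asymptotic (a : nat -> C) (N : nat) (s l : C) :
  abs_summable a -> 0 <= Re s -> is_series (dterm a s) l ->
  Cmod (l - sum_n (dterm a s) N)
    <= Series (coef_abs a) * exp (- ln (INR (S N)) * Re s).
Proof.
  intros Ha Hs Hl. set (q := exp _).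
  assert (Hq : 0 < q) by apply exp_pos.
  rewrite Rmult_comm, <- Series_scal_l.
  apply (is_series_C_Cmod_le _ _ (fun n => q * coef_abs a n)
           (is_series_C_minus _ _ _ _ Hl (is_series_C_trunc _ N))).
  - exact (ex_series_scal_l q _ Ha).
  - intros n. assert (A0 := coef_abs_nonneg a n).
    destruct (Nat.leb_spec n N) as [H|H].
    + replace (dterm a s n - dterm a s n)%C with (RtoC 0) by ring.
      rewrite Cmod_0. apply Rmult_le_pos; lra.
    + replace (dterm a s n - 0)%C with (dterm a s n) by ring.
      rewrite Cmod_dterm, Rmult_comm. apply Rmult_le_compat_r; auto.
      apply exp_le_compat. rewrite !Ropp_mult_distr_l_reverse.
      apply Ropp_le_contravar, Rmult_le_compat_r; auto. apply ln_INR_le; lia.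
Qed.

Lemma exp_ge_1_minus (x : R) : 1 - x <= exp (- x).
Proof.
  destruct (Req_dec x 0) as [->|H].
  - rewrite Ropp_0, exp_0; lra.
  - assert (- x <> 0) by lra. generalize (exp_ineq1 (- x) H0); lra.
Qed.

Lemma npow_neg_real_shift (n : nat) (x : R) :
  npow_neg n (RtoC x) = RtoC (exp (- ln (INR n) * x)).
Proof.
  unfold npow_neg, cexp. rewrite <- RtoC_mult. simpl. rewrite cos_0, sin_0.
  unfold RtoC; f_equal; ring.
Qed.

(** Serves to carry bounds and identities from the open half-plane to the line [Re z = 0]. A real
    shift [y] multiplies the term of index [n] by a real number in (0,1] that differs from 1 by at
    most [y ln n]. *)
Lemma dirichlet_right_continuous (a : nat -> C) (z l : C) (eps : R) :
  abs_summable a -> 0 <= Re z -> is_series (dterm a z) l -> 0 < eps ->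
  exists x, 0 < x /\ forall y l', 0 < y <= x ->
    is_series (dterm a (z + RtoC y)) l' -> Cmod (l' - l) <= eps.
Proof.
  intros Ha Hz Hl He.
  set (S := Series (coef_abs a)).
  assert (HS : 0 <= S) by (apply Series_nonneg; auto; apply coef_abs_nonneg).
  destruct (series_split_bound (coef_abs a) (eps / 4)) as [K HK];
    [apply coef_abs_nonneg | auto | lra |].
  assert (LK := ln_INR_nonneg K).
  (* Half of [eps] is for the indices below [K], half for the tail; the two [+ 1] keep the
     denominator positive. *)
  set (x := eps / 2 / ((S + 1) * (ln (INR K) + 1))).
  assert (Hx : 0 < x).
  { apply Rdiv_lt_0_compat; [lra|]. apply Rmult_lt_0_compat; lra. }
  exists x; split; auto. intros y l' [Hy Hyx] Hl'.
  assert (E : ln (INR K) * y * S + 2 * (eps / 4) <= eps).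
  { assert (Ex : (ln (INR K) + 1) * x * (S + 1) = eps / 2) by (unfold x; field; lra).
    assert (ln (INR K) * y * S <= (ln (INR K) + 1) * x * (S + 1)).
    { apply Rmult_le_compat; try lra; [apply Rmult_le_pos; lra|].
      apply Rmult_le_compat; lra. }
    lra. }
  eapply Rle_trans; [|exact E].
  assert (W : forall n, Cmod (dterm a (z + RtoC y) n - dterm a z n)
      <= (1 - exp (- (ln (INR n) * y))) * coef_abs a n).
  { intros n. destruct n as [|n].
    - simpl. replace (RtoC 0 - RtoC 0)%C with (RtoC 0) by ring. rewrite Cmod_0. lra.
    - simpl dterm. rewrite npow_neg_plus, npow_neg_real_shift.
      set (r := exp _). replace (exp (- (ln (INR (Datatypes.S n)) * y))) with r
        by (unfold r; f_equal; ring).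
      assert (Hr : r <= 1).
      { unfold r; rewrite <- exp_0. apply exp_le_compat.
        assert (0 <= ln (INR (Datatypes.S n)) * y)
          by (apply Rmult_le_pos; [apply ln_INR_nonneg | lra]). lra. }
      replace (a (Datatypes.S n) * (npow_neg (Datatypes.S n) z * r)
               - a (Datatypes.S n) * npow_neg (Datatypes.S n) z)%C
        with (a (Datatypes.S n) * npow_neg (Datatypes.S n) z * RtoC (r - 1))%C
        by (rewrite RtoC_minus; ring).
      rewrite !Cmod_mult, Cmod_R, (Rabs_left1 (r - 1)) by lra.
      replace (- (r - 1)) with (1 - r) by ring. rewrite Rmult_comm.
      apply Rmult_le_compat_l; [lra|]. simpl coef_abs.
      rewrite <- (Rmult_1_r (Cmod (a _))) at 2.
      apply Rmult_le_compat_l; [apply Cmod_ge_0 | apply Cmod_npow_neg_le_1; auto]. }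
  apply (HK _ _ _ _ (Rmult_le_pos _ _ LK (Rlt_le _ _ Hy)) (Rlt_le _ _ Rlt_0_2)
           (is_series_C_minus _ _ _ _ Hl' Hl)).
  - intros n _. eapply Rle_trans; [apply W|].
    apply Rmult_le_compat_r; [apply coef_abs_nonneg|].
    generalize (exp_pos (- (ln (INR n) * y))); lra.
  - intros n Hn. eapply Rle_trans; [apply W|].
    apply Rmult_le_compat_r; [apply coef_abs_nonneg|].
    assert (H := exp_ge_1_minus (ln (INR n) * y)).
    assert (ln (INR n) * y <= ln (INR K) * y); [|lra].
    apply Rmult_le_compat_r; [lra|].
    destruct n; [|apply ln_INR_le; lia].
    eapply Rle_trans; [|apply LK]. simpl. unfold ln.
    destruct (Rlt_dec 0 0); [exfalso; lra | apply Rle_refl].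
Qed.

(** * The algebra structure of A^+ *)

(** The test [i * (n / i) = n] selects the divisors of a positive [n]. A general ring lets the same
    sum act on complex coefficients and on their absolute values. *)
Definition conv {K : Ring} (a b : nat -> K) (n : nat) : K :=
  sum_n (fun i => if Nat.eqb (i * (n / i)) n then mult (a i) (b (n / i)%nat) else zero) n.

(** From [N] to [N + 1] the quotient [N / i] changes only for the divisors [i] of [N + 1], and then
    by exactly one; the new terms are those of the convolution at [N + 1]. *)
Lemma sum_conv {K : Ring} (a b : nat -> K) (N : nat) :
  a 0%nat = zero -> b 0%nat = zero ->
  sum_n (conv a b) N = sum_n (fun i => mult (a i) (sum_n b (N / i))) N.
Proof.
  intros Ha Hb. induction N as [|N IH].
  - rewrite !sum_O. unfold conv. rewrite sum_O. simpl Nat.eqb. cbv iota. rewrite Ha, !mult_zero_l. reflexivity.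
  - rewrite sum_Sn, IH.
    transitivity (plus (sum_n (fun i => mult (a i) (sum_n b (N / i))) (S N))
                       (conv a b (S N))).
    + f_equal. rewrite sum_Sn, (Nat.div_small N (S N)) by lia.
      rewrite sum_O, Hb, mult_zero_r, plus_zero_r. reflexivity.
    + unfold conv. rewrite <- sum_n_plus. apply sum_n_ext. intros i.
      destruct i as [|i].
      { rewrite Ha, !mult_zero_l. simpl. apply plus_zero_r. }
      set (j := S i) in *. assert (Hj : j <> 0%nat) by (unfold j; lia).
      assert (D := Nat.div_mod (S N) j Hj).
      assert (M := Nat.mod_upper_bound (S N) j Hj).
      remember (S N / j)%nat as q.
      destruct (Nat.eqb_spec (j * q) (S N)) as [E|E].
      * destruct q as [|q]; [lia|].
        replace (N / j)%nat with q.
        2:{ apply (Nat.div_unique N j q (j - 1)); lia. }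
        rewrite sum_Sn, mult_distr_l. reflexivity.
      * replace (N / j)%nat with q; [apply plus_zero_r|].
        apply (Nat.div_unique N j q (S N mod j - 1)); lia.
Qed.

(** The coefficient of index 0 is arbitrary for [abs_summable] and [dterm], but [sum_conv] requires
    it to vanish. *)
Definition reset0 (a : nat -> C) (n : nat) : C := match n with O => 0 | S _ => a n end.

Lemma Cmod_reset0 (a : nat -> C) (n : nat) : Cmod (reset0 a n) = coef_abs a n.
Proof. destruct n; simpl; [apply Cmod_0 | reflexivity]. Qed.

Definition dirichlet_conv (a b : nat -> C) : nat -> C :=
  conv (K := C_Ring) (reset0 a) (reset0 b).

Lemma abs_summable_conv (a b : nat -> C) :
  abs_summable a -> abs_summable b -> abs_summable (dirichlet_conv a b).
Proof.
  intros Ha Hb.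
  set (SA := Series (coef_abs a)). set (SB := Series (coef_abs b)).
  assert (HB : 0 <= SB) by (apply Series_nonneg; auto; apply coef_abs_nonneg).
  apply (ex_series_bounded (coef_abs (dirichlet_conv a b)) (SB * SA)).
  { apply coef_abs_nonneg. }
  intros N. apply Rle_trans with (sum_n (conv (K := R_Ring) (coef_abs a) (coef_abs b)) N).
  - apply sum_n_Rle. intros n. rewrite <- Cmod_reset0.
    destruct n as [|n]; simpl reset0.
    + rewrite Cmod_0. unfold conv; rewrite sum_O. simpl. unfold mult; simpl. lra.
    + apply (Cmod_sum_n_le _ _ (S n)). intros k _.
      destruct (Nat.eqb _ _).
      * change (Cmod (reset0 a k * reset0 b (S n / k))
                <= coef_abs a k * coef_abs b (S n / k)).
        rewrite Cmod_mult, !Cmod_reset0. apply Rle_refl.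
      * change (Cmod 0 <= 0). rewrite Cmod_0; apply Rle_refl.
  - rewrite (sum_conv (K := R_Ring)) by reflexivity.
    apply Rle_trans with (sum_n (fun i => SB * coef_abs a i) N).
    + apply sum_n_Rle. intros k. rewrite (Rmult_comm SB).
      apply Rmult_le_compat_l; [apply coef_abs_nonneg|].
      apply sum_n_le_Series; auto. apply coef_abs_nonneg.
    + rewrite (sum_n_mult_l (K := R_Ring) SB).
      apply Rmult_le_compat_l; auto. apply sum_n_le_Series; auto. apply coef_abs_nonneg.
Qed.

Lemma dterm_conv (a b : nat -> C) (s : C) (n : nat) :
  dterm (dirichlet_conv a b) s n = conv (K := C_Ring) (dterm a s) (dterm b s) n.
Proof.
  destruct n as [|n].
  - unfold conv; rewrite sum_O. simpl. unfold mult; simpl. ring.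
  - simpl dterm. unfold dirichlet_conv, conv.
    change (mult (sum_n (fun i => if (i * (S n / i) =? S n)%nat
        then mult (reset0 a i) (reset0 b (S n / i)%nat) else zero) (S n) : C_Ring)
          (npow_neg (S n) s)
       = sum_n (fun i => if (i * (S n / i) =? S n)%nat
        then mult (dterm a s i : C_Ring) (dterm b s (S n / i)%nat) else zero) (S n)).
    rewrite <- sum_n_mult_r. apply sum_n_ext. intros i.
    destruct (Nat.eqb_spec (i * (S n / i)) (S n)) as [E|E]; [|apply mult_zero_l].
    rewrite <- E at 2.
    set (j := (S n / i)%nat) in *. destruct i as [|i]; [lia|]. destruct j as [|j]; [lia|].
    rewrite npow_neg_mult by lia. simpl reset0; simpl dterm. unfold mult; simpl. ring.
Qed.

(** A Mertens argument: by [sum_conv] the partial sum is that of [a] weighted by partial sums of [b]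
    at [N / i]. For small [i] these are close to [B]; for large [i] the absolutely convergent tail
    of [a] takes over. *)
Lemma is_series_conv (a b : nat -> C) (s A B : C) :
  abs_summable a -> abs_summable b -> 0 <= Re s ->
  is_series (dterm a s) A -> is_series (dterm b s) B ->
  is_series (dterm (dirichlet_conv a b) s) (A * B)%C.
Proof.
  intros Ha Hb Hs HA HB.
  apply (is_series_C_ext (conv (K := C_Ring) (dterm a s) (dterm b s)));
    [intros n; symmetry; apply dterm_conv|].
  apply is_series_C_eps; intros eps He.
  set (SA := Series (coef_abs a)). set (SB := Series (coef_abs b)).
  assert (HSA : 0 <= SA) by (apply Series_nonneg; auto; apply coef_abs_nonneg).
  assert (HSB : 0 <= SB) by (apply Series_nonneg; auto; apply coef_abs_nonneg).
  set (d := eps / 4 / (SA + 1)). set (e := eps / 4 / (2 * SB + 1)).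
  assert (Hd : 0 < d) by (apply Rdiv_lt_0_compat; lra).
  assert (He' : 0 < e) by (apply Rdiv_lt_0_compat; lra).
  assert (Bd : d * SA + (2 * SB) * e < eps).
  { assert (d * (SA + 1) = eps / 4) by (unfold d; field; lra).
    assert ((2 * SB + 1) * e = eps / 4) by (unfold e; field; lra). nra. }
  destruct (series_split_bound (coef_abs a) e) as [K HK];
    [apply coef_abs_nonneg | auto | auto |].
  destruct (proj1 (is_series_C_eps _ _) HB d Hd) as [J HJ].
  assert (HSBn : forall m, Cmod (sum_n (dterm b s) m) <= SB).
  { intros m. eapply Rle_trans; [apply (Cmod_sum_n_le _ (coef_abs b))|].
    - intros k _; apply Cmod_dterm_le; auto.
    - apply sum_n_le_Series; auto. apply coef_abs_nonneg. }
  assert (HBB : Cmod B <= SB) by (apply (is_series_C_bound _ _ _ HB); auto).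
  (* For [0 < i < K] this makes [N / i] at least [J]; the successor also ensures [i <= N] when
     [J = 0]. *)
  exists (K * S J)%nat. intros N HN.
  eapply Rle_lt_trans; [|exact Bd].
  rewrite (sum_conv (K := C_Ring)) by reflexivity.
  assert (HW := is_series_C_minus _ _ _ _
    (is_series_C_trunc (fun i => dterm a s i * sum_n (dterm b s) (N / i))%C N)
    (is_series_C_scal B _ _ HA)).
  rewrite (Cmult_comm A B).
  apply (HK _ _ _ _ (Rlt_le _ _ Hd) (Rmult_le_pos _ _ (Rlt_le _ _ Rlt_0_2) HSB) HW).
  - intros n _.
    apply Rle_trans with (Cmod (dterm a s n) * (2 * SB)).
    + destruct (Nat.leb_spec n N).
      * replace (dterm a s n * sum_n (dterm b s) (N / n) - B * dterm a s n)%C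
          with (dterm a s n * (sum_n (dterm b s) (N / n) - B))%C by ring.
        rewrite Cmod_mult. apply Rmult_le_compat_l; [apply Cmod_ge_0|].
        eapply Rle_trans; [apply Cmod_triangle|]. rewrite Cmod_opp.
        specialize (HSBn (N / n)%nat). lra.
      * replace (0 - B * dterm a s n)%C with (- (dterm a s n * B))%C by ring.
        rewrite Cmod_opp, Cmod_mult. apply Rmult_le_compat_l; [apply Cmod_ge_0|]. lra.
    + rewrite Rmult_comm. apply Rmult_le_compat_l; [lra|]. apply Cmod_dterm_le; auto.
  - intros n Hn. destruct n as [|n].
    { simpl dterm. simpl Nat.leb. cbv iota.
      replace (0 * sum_n (dterm b s) (N / 0) - B * 0)%C with (RtoC 0) by ring.
      rewrite Cmod_0. simpl; lra. }
    assert (HnN : (S n <= N)%nat) by nia.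
    destruct (Nat.leb_spec (S n) N); [|lia].
    replace (dterm a s (S n) * sum_n (dterm b s) (N / S n) - B * dterm a s (S n))%C
      with ((sum_n (dterm b s) (N / S n) - B) * dterm a s (S n))%C by ring.
    rewrite Cmod_mult. apply Rmult_le_compat; try apply Cmod_ge_0.
    + left. apply HJ. apply Nat.div_le_lower_bound; [lia|]. nia.
    + apply Cmod_dterm_le; auto.
Qed.

Lemma in_Aplus_mult (f g : C -> C) :
  in_Aplus f -> in_Aplus g -> in_Aplus (fun s => f s * g s)%C.
Proof.
  intros [a [Ha Hf]] [b [Hb Hg]]. exists (dirichlet_conv a b); split.
  - apply abs_summable_conv; auto.
  - intros s Hs. apply is_series_conv; auto.
Qed.

Lemma in_Aplus_lin (c d : C) (f g : C -> C) :
  in_Aplus f -> in_Aplus g -> in_Aplus (fun s => c * f s + d * g s)%C.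
Proof.
  intros [a [Ha Hf]] [b [Hb Hg]]. exists (fun n => c * a n + d * b n)%C; split.
  - apply (ex_series_bounded (coef_abs (fun n => c * a n + d * b n)%C)
      (Cmod c * Series (coef_abs a) + Cmod d * Series (coef_abs b))).
    { apply coef_abs_nonneg. }
    intros N. apply Rle_trans with
      (sum_n (fun k => Cmod c * coef_abs a k + Cmod d * coef_abs b k) N).
    + apply sum_n_Rle. intros [|n]; simpl; [lra|].
      rewrite <- !Cmod_mult. apply Cmod_triangle.
    + rewrite sum_n_Rlin. apply Rplus_le_compat;
        (apply Rmult_le_compat_l; [apply Cmod_ge_0|];
         apply sum_n_le_Series; auto; apply coef_abs_nonneg).
  - intros s Hs.
    apply (is_series_C_ext (fun n => c * dterm a s n + d * dterm b s n)%C).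
    + intros [|n]; simpl; ring.
    + apply is_series_C_plus; apply is_series_C_scal; auto.
Qed.

Lemma in_Aplus_npow_neg (n : nat) : (0 < n)%nat -> in_Aplus (npow_neg n).
Proof.
  intros Hn. exists (fun k => if Nat.eqb k n then RtoC 1 else RtoC 0); split.
  - apply (ex_series_bounded
      (coef_abs (fun k => if Nat.eqb k n then RtoC 1 else RtoC 0)) 1).
    { apply coef_abs_nonneg. }
    intros N. apply Rle_trans with (Re (sum_n (fun k => if Nat.eqb k n then RtoC 1 else RtoC 0) N)).
    + right. induction N as [|N IH].
      * rewrite !sum_O. destruct n; [lia|reflexivity].
      * rewrite !sum_Sn, IH. unfold coef_abs.
        destruct (Nat.eqb (S N) n); rewrite ?Cmod_1, ?Cmod_0; reflexivity.
    + rewrite sum_n_single. destruct (Nat.leb n N); simpl; lra.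
  - intros s _. apply (is_series_C_ext (fun k => if Nat.eqb k n then npow_neg n s else RtoC 0)).
    + intros k. destruct (Nat.eqb_spec k n) as [->|H].
      * destruct n; [lia|]. cbn [dterm]. rewrite Nat.eqb_refl. ring.
      * destruct k as [|k]; [reflexivity|]. cbn [dterm].
        destruct (Nat.eqb_spec (S k) n); [lia|symmetry; apply Cmult_0_l].
    + apply is_series_C_single.
Qed.

(** * Geometric series in A^+, supported on the powers of 2 *)

(** [Nat.log2] steps up from [n] to [n + 1] exactly when [n + 1] is a power of two, that is, exactly
    when a new nonzero term appears. *)
Lemma sum_n_pow2 {G : AbelianMonoid} (v : nat -> G) (N : nat) :
  sum_n (fun n => match n with
                  | O => zero
                  | S _ => if Nat.eqb (2 ^ Nat.log2 n) n then v (Nat.log2 n) else zero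
                  end) (S N)
  = sum_n v (Nat.log2 (S N)).
Proof.
  induction N as [|N IH].
  - rewrite sum_Sn, sum_O. change (Nat.log2 1) with 0%nat.
    rewrite sum_O. simpl. apply plus_zero_l.
  - rewrite sum_Sn, IH.
    destruct (Nat.log2_succ_or (S N)) as [E|E].
    + destruct (Nat.log2_eq_succ_is_pow2 _ E) as [j Hj].
      replace (2 ^ Nat.log2 (S (S N)))%nat with (S (S N))
        by (rewrite Hj, Nat.log2_pow2; lia).
      rewrite Nat.eqb_refl, E, sum_Sn. reflexivity.
    + destruct (Nat.eqb_spec (2 ^ Nat.log2 (S (S N))) (S (S N))) as [E'|E'].
      * assert (E2 : Nat.log2 (S (S N)) = S (Nat.log2 (S N))).
        { apply Nat.log2_eq_succ_iff_pow2; [lia|]. eexists; symmetry; exact E'. }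
        lia.
      * rewrite E. apply plus_zero_r.
Qed.

Lemma npow_neg_pow (n j : nat) (s : C) :
  (0 < n)%nat -> npow_neg (n ^ j) s = (npow_neg n s ^ j)%C.
Proof.
  intros Hn. induction j as [|j IH].
  - apply npow_neg_1.
  - rewrite Nat.pow_succ_r', npow_neg_mult, IH; auto.
    apply Nat.neq_0_lt_0, Nat.pow_nonzero; lia.
Qed.

Lemma geom_sum_C (w : C) (n : nat) :
  ((1 - w) * sum_n (fun j => w ^ j)%C n)%C = (1 - w ^ S n)%C.
Proof.
  induction n as [|n IH].
  - rewrite sum_O. simpl. ring.
  - rewrite sum_Sn. unfold plus; simpl. rewrite Cmult_plus_distr_l.
    change ((1 - w) * sum_n (fun j => w ^ j) n + (1 - w) * w ^ S n = 1 - w * w ^ S n)%C.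
    rewrite IH. ring.
Qed.

Lemma in_Aplus_geom (mu : C) :
  Cmod mu < 1 -> in_Aplus (fun s => / (1 - mu * npow_neg 2 s))%C.
Proof.
  intros Hmu.
  exists (fun n => if Nat.eqb (2 ^ Nat.log2 n) n then (mu ^ Nat.log2 n)%C else RtoC 0).
  split.
  - match goal with |- abs_summable ?a =>
      apply (ex_series_bounded (coef_abs a) (Series (fun j => Cmod mu ^ j)));
      [apply coef_abs_nonneg|] end.
    assert (Hp : forall k, 0 <= Cmod mu ^ k) by (intros; apply pow_le, Cmod_ge_0).
    assert (Hg : ex_series (fun j => Cmod mu ^ j)).
    { apply ex_series_geom. rewrite Rabs_pos_eq; auto. apply Cmod_ge_0. }
    intros [|N].
    + rewrite sum_O. apply Series_nonneg; auto.
    + apply Rle_trans with (sum_n (fun n => match n with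
                  | O => zero
                  | S _ => if Nat.eqb (2 ^ Nat.log2 n) n then Cmod mu ^ (Nat.log2 n) else zero
                  end) (S N)).
      * apply sum_n_Rle. intros [|n]; cbn [coef_abs]; [apply Rle_refl|].
        destruct (Nat.eqb _ _); [rewrite Cmod_pow | rewrite Cmod_0]; apply Rle_refl.
      * rewrite (sum_n_pow2 (fun j => Cmod mu ^ j)). apply sum_n_le_Series; auto.
  - intros s Hs. set (w := (mu * npow_neg 2 s)%C).
    assert (Hw : Cmod w < 1).
    { unfold w. rewrite Cmod_mult. eapply Rle_lt_trans; [|exact Hmu].
      rewrite <- (Rmult_1_r (Cmod mu)) at 2.
      apply Rmult_le_compat_l; [apply Cmod_ge_0 | apply Cmod_npow_neg_le_1; auto]. }
    assert (Hw1 : 0 < Cmod (1 - w)).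
    { assert (T := Cmod_triangle (1 - w) w).
      replace (1 - w + w)%C with (RtoC 1) in T by ring. rewrite Cmod_1 in T. lra. }
    assert (Hw0 : (1 - w)%C <> 0%C) by (apply Cmod_gt_0; auto).
    apply (is_series_C_ext (fun n => match n with
                  | O => zero
                  | S _ => if Nat.eqb (2 ^ Nat.log2 n) n then (w ^ Nat.log2 n)%C else zero
                  end)).
    + intros [|n]; [reflexivity|]. cbn [dterm].
      destruct (Nat.eqb_spec (2 ^ Nat.log2 (S n)) (S n)) as [E|E];
        [|symmetry; apply Cmult_0_l].
      rewrite <- E at 3. rewrite npow_neg_pow by lia. unfold w.
      apply Cpow_mult_l.
    + apply is_series_C_eps; intros eps He.
      destruct (pow_lt_1_zero (Cmod w)) with (y := eps * Cmod (1 - w)) as [J HJ].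
      { rewrite Rabs_pos_eq; auto. apply Cmod_ge_0. }
      { apply Rmult_lt_0_compat; auto. }
      exists (2 ^ J)%nat. intros n Hn.
      assert (Hn0 : (0 < n)%nat).
      { eapply Nat.lt_le_trans; [|exact Hn]. apply Nat.neq_0_lt_0, Nat.pow_nonzero; lia. }
      destruct n as [|n]; [lia|]. rewrite (sum_n_pow2 (fun j => w ^ j)%C).
      assert (HJn : (J <= Nat.log2 (S n))%nat) by (apply Nat.log2_le_pow2; auto).
      set (m := Nat.log2 (S n)) in *.
      assert (E := geom_sum_C w m).
      replace (sum_n (fun j => w ^ j) m - / (1 - w))%C
        with ((- (w ^ S m)) / (1 - w))%C.
      2:{ replace (sum_n (fun j => w ^ j)%C m) with ((1 - w ^ S m) / (1 - w))%C.
          - field; auto.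
          - rewrite <- E. field; auto. }
      rewrite Cmod_div, Cmod_opp, Cmod_pow by auto.
      apply Rlt_div_l; auto.
      specialize (HJ (S m) ltac:(lia)). rewrite Rabs_pos_eq in HJ; auto.
      apply pow_le, Cmod_ge_0.
Qed.

(* If [f s0 = lambda] with [|lambda| > 1], then [1 - 2^(-s)/lambda] is invertible in
   A^+, hence so is its preimage [1 - f/lambda], although the latter vanishes at [s0]. *)
Lemma preimage_bound (phi : C -> C) (f : C -> C) :
  Cphi_bijective phi -> (forall s, 0 < Re s -> 0 < Re (phi s)) -> in_Aplus f ->
  (forall s, 0 < Re s -> f (phi s) = npow_neg 2 s) ->
  forall s0, 0 <= Re s0 -> Cmod (f s0) <= 1.
Proof.
  intros [Hinj Hsurj] Hmaps Hf Hfphi s0 Hs0.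
  apply Rnot_lt_le; intros Hgt.
  assert (Hne : f s0 <> 0%C) by (apply Cmod_gt_0; lra).
  set (mu := (/ f s0)%C).
  assert (Hmu : Cmod mu < 1).
  { unfold mu. rewrite Cmod_inv by auto. rewrite <- Rinv_1.
    apply Rinv_lt_contravar; lra. }
  destruct (Hsurj _ (in_Aplus_geom mu Hmu)) as [v [Hv Hvphi]].
  (* [npow_neg 1] is the constant 1. Injectivity turns [v (1 - mu f) = 1], known on the image of
     [phi], into an identity on all of [Re s >= 0], in particular at [s0]. *)
  assert (E := Hinj (fun s => v s * (1 * npow_neg 1 s + (- mu) * f s))%C (npow_neg 1)).
  assert (Z : (v s0 * (1 * npow_neg 1 s0 + - mu * f s0))%C = npow_neg 1 s0).
  { apply E; auto.
    - apply (in_Aplus_mult v); auto. apply in_Aplus_lin; auto. apply in_Aplus_npow_neg; lia.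
    - apply in_Aplus_npow_neg; lia.
    - intros s Hs. rewrite !npow_neg_1, Hvphi, Hfphi by auto.
      assert (Hlt : Cmod (mu * npow_neg 2 s) < 1).
      { rewrite Cmod_mult. eapply Rle_lt_trans; [|exact Hmu].
        rewrite <- (Rmult_1_r (Cmod mu)) at 2.
        apply Rmult_le_compat_l; [apply Cmod_ge_0 | apply Cmod_npow_neg_le_1; lra]. }
      field. intros H0.
      assert (H1 : (mu * npow_neg 2 s)%C = 1%C).
      { replace (mu * npow_neg 2 s)%C with (1 - (1 - mu * npow_neg 2 s))%C by ring.
        rewrite H0. ring. }
      rewrite H1, Cmod_1 in Hlt. lra. }
  rewrite npow_neg_1 in Z. unfold mu in Z.
  replace (v s0 * (1 * 1 + - / f s0 * f s0))%C with (RtoC 0) in Z by (field; auto).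
  apply RtoC_inj in Z. lra.
Qed.

(** * Coefficients of a Dirichlet series bounded on the imaginary axis *)

Definition e_it (x : R) : C := cexp (0, x).

Lemma e_it_plus (x y : R) : e_it (x + y) = (e_it x * e_it y)%C.
Proof.
  unfold e_it. rewrite <- cexp_plus. f_equal. unfold Cplus; simpl. f_equal; ring.
Qed.

Lemma e_it_0 : e_it 0 = 1%C.
Proof. exact cexp_0. Qed.

Lemma Cmod_e_it (x : R) : Cmod (e_it x) = 1.
Proof. unfold e_it. rewrite Cmod_cexp. simpl. apply exp_0. Qed.

Lemma e_it_PI : e_it PI = (-1)%C.
Proof.
  unfold e_it, cexp; simpl. rewrite exp_0, cos_PI, sin_PI. unfold RtoC. f_equal; ring.
Qed.

Lemma Cconj_e_it (x : R) : Cconj (e_it x) = e_it (- x).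
Proof.
  unfold e_it, cexp, Cconj; simpl. rewrite cos_neg, sin_neg. f_equal; ring.
Qed.

(** Sums over a finite list of times replace the limits of integral means used for almost periodic
    functions: a suitable list annihilates finitely many frequencies exactly. *)
Definition csum (F : R -> C) (T : list R) : C :=
  fold_right (fun t acc => F t + acc)%C 0%C T.

Lemma csum_app (F : R -> C) (T T' : list R) :
  csum F (T ++ T') = (csum F T + csum F T')%C.
Proof. induction T as [|t T IH]; simpl; [|rewrite IH]; ring. Qed.

Lemma csum_map (F : R -> C) (g : R -> R) (T : list R) :
  csum F (map g T) = csum (fun t => F (g t)) T.
Proof. induction T as [|t T IH]; simpl; [|rewrite IH]; reflexivity. Qed.

Lemma csum_ext (F G : R -> C) (T : list R) :
  (forall t, F t = G t) -> csum F T = csum G T.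
Proof. intros H. induction T as [|t T IH]; simpl; [|rewrite IH, H]; reflexivity. Qed.

Lemma csum_scal (c : C) (F : R -> C) (T : list R) :
  csum (fun t => c * F t)%C T = (c * csum F T)%C.
Proof. induction T as [|t T IH]; simpl; [|rewrite IH]; ring. Qed.

Lemma csum_plus (F G : R -> C) (T : list R) :
  csum (fun t => F t + G t)%C T = (csum F T + csum G T)%C.
Proof. induction T as [|t T IH]; simpl; [|rewrite IH]; ring. Qed.

Lemma csum_one (T : list R) : csum (fun _ => 1%C) T = RtoC (INR (length T)).
Proof.
  induction T as [|t T IH]; [reflexivity|].
  cbn [length]. rewrite S_INR, RtoC_plus, <- IH. simpl. ring.
Qed.

Lemma Cmod_csum_le (F : R -> C) (T : list R) :
  (forall t, Cmod (F t) <= 1) -> Cmod (csum F T) <= INR (length T).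
Proof.
  intros H. induction T as [|t T IH].
  - simpl. rewrite Cmod_0; lra.
  - cbn [length]. rewrite S_INR. simpl csum. eapply Rle_trans; [apply Cmod_triangle|].
    specialize (H t). lra.
Qed.

(* Averaging over [t] and [t + pi/lambda] kills the frequency [lambda] and keeps
   the dead frequencies dead. *)
Lemma kill_frequencies (L : list R) :
  (forall x, In x L -> x <> 0) ->
  exists T : list R, (0 < length T)%nat /\
    forall x, In x L -> csum (fun t => e_it (x * t)) T = 0%C.
Proof.
  induction L as [|y L IH]; intros HL.
  - exists [0]; split; [simpl; lia|]. intros x [].
  - destruct IH as [T [HT HTL]]; [intros x Hx; apply HL; right; auto|].
    assert (Hy : y <> 0) by (apply HL; left; auto).
    set (h := PI / y).
    exists (T ++ map (fun t => t + h) T); split.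
    { rewrite length_app; lia. }
    assert (E : forall x, csum (fun t => e_it (x * t)) (T ++ map (fun t => t + h) T)
        = ((1 + e_it (x * h)) * csum (fun t => e_it (x * t)) T)%C).
    { intros x. rewrite csum_app, csum_map, Cmult_plus_distr_r, Cmult_1_l.
      f_equal. rewrite <- csum_scal. apply csum_ext. intros t.
      rewrite <- e_it_plus. f_equal; ring. }
    intros x [->|Hx]; rewrite E.
    + replace (x * h) with PI by (unfold h; field; auto). rewrite e_it_PI. ring.
    + rewrite HTL by auto. ring.
Qed.

Lemma is_series_csum (u : nat -> C) (lam : nat -> R) (F : R -> C) (T : list R) :
  (forall t, is_series (fun n => u n * e_it (lam n * t))%C (F t)) ->
  is_series (fun n => u n * csum (fun t => e_it (lam n * t)) T)%C (csum F T).
Proof.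
  intros H. induction T as [|t T IH].
  - apply (is_series_C_ext (fun n => 0 * (u n * e_it (lam n * 0)))%C).
    { intros n; simpl; ring. }
    replace (csum F []) with (0 * F 0)%C by (simpl; ring).
    apply is_series_C_scal, H.
  - apply (is_series_C_ext (fun n => u n * e_it (lam n * t)
      + u n * csum (fun t => e_it (lam n * t)) T)%C).
    { intros n; simpl; ring. }
    apply is_series_C_plus; auto.
Qed.

(** [K] depends only on [D] and [eps], so it can be fixed first and [T] built afterwards to
    annihilate the frequencies of index below [K]. The other indices cost at most [eps] per time. *)
Lemma mean_coefficient (D : nat -> R) (eps : R) :
  (forall k, 0 <= D k) -> ex_series D -> 0 < eps ->
  exists K, forall (u : nat -> C) (lam : nat -> R) (F : R -> C) (T : list R) (p : nat),
    (forall n, Cmod (u n) <= D n) ->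
    (forall t, is_series (fun n => u n * e_it (lam n * t))%C (F t)) ->
    (forall n, (n < K)%nat -> n <> p ->
       u n = 0%C \/ csum (fun t => e_it (lam n * t)) T = 0%C) ->
    Cmod (csum F T - u p * csum (fun t => e_it (lam p * t)) T)
      <= INR (length T) * eps.
Proof.
  intros HD Hs He. destruct (series_split_bound D eps HD Hs He) as [K HK].
  exists K. intros u lam F T p Hu HF Hkill.
  set (k := fun n => csum (fun t => e_it (lam n * t)) T) in *.
  assert (HT := pos_INR (length T)).
  assert (HW := is_series_C_minus _ _ _ _ (is_series_csum u lam F T HF)
                  (is_series_C_single p (u p * k p)%C)).
  replace (INR (length T) * eps) with (0 * Series D + INR (length T) * eps) by ring.
  apply (HK _ _ 0 (INR (length T)) (Rle_refl 0) HT HW).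
  - intros n Hn. destruct (Nat.eqb_spec n p) as [->|Hp].
    + fold (k p). replace (u p * k p - u p * k p)%C with (RtoC 0) by ring.
      rewrite Cmod_0. apply Rmult_le_pos; auto.
    + fold (k n). replace (u n * k n - 0)%C with (k n * u n)%C by ring.
      rewrite Cmod_mult. apply Rmult_le_compat; try apply Cmod_ge_0; auto.
      apply Cmod_csum_le. intros t. rewrite Cmod_e_it; lra.
  - intros n Hn. rewrite Rmult_0_l. right.
    destruct (Nat.eqb_spec n p) as [->|Hp].
    + fold (k p). replace (u p * k p - u p * k p)%C with (RtoC 0) by ring. apply Cmod_0.
    + fold (k n). replace (u n * k n - 0)%C with (RtoC 0); [apply Cmod_0|].
      unfold k; destruct (Hkill n Hn Hp) as [->| ->]; ring.
Qed.

(** Supplies the phase of the kernel, for which the two surviving coefficients add up without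
    cancellation. *)
Lemma align_phase (x y : C) :
  exists xi : C, Cmod xi = 1 /\ Cmod (x + xi * y) = Cmod x + Cmod y.
Proof.
  destruct (Req_dec (Cmod x) 0) as [Hx|Hx].
  - exists 1%C. rewrite (Cmod_eq_0 x Hx), Cmod_1, Cmod_0. split; auto.
    replace (0 + 1 * y)%C with y by ring. ring.
  - destruct (Req_dec (Cmod y) 0) as [Hy|Hy].
    + exists 1%C. rewrite (Cmod_eq_0 y Hy), Cmod_1, Cmod_0. split; auto.
      replace (x + 1 * 0)%C with x by ring. ring.
    + assert (X : x <> 0%C) by (intros ->; apply Hx, Cmod_0).
      assert (Y : y <> 0%C) by (intros ->; apply Hy, Cmod_0).
      assert (X' : RtoC (Cmod x) <> 0%C) by (intros H; apply RtoC_inj in H; auto).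
      assert (Px := proj1 (Cmod_gt_0 x) X). assert (Py := proj1 (Cmod_gt_0 y) Y).
      exists (x / Cmod x * (Cmod y / y))%C. split.
      * rewrite Cmod_mult, !Cmod_div, !Cmod_R, !Rabs_pos_eq by (auto; lra).
        field; auto.
      * replace (x + x / Cmod x * (Cmod y / y) * y)%C
          with (x / Cmod x * RtoC (Cmod x + Cmod y))%C
          by (rewrite RtoC_plus; field; auto).
        rewrite Cmod_mult, Cmod_div, !Cmod_R, !Rabs_pos_eq by (auto; lra).
        field; auto.
Qed.

Lemma Cmod_csum_kernel (F : R -> C) (xi : C) (x : R) (T : list R) :
  (forall t, Cmod (F t) <= 1 + Re (xi * e_it (x * t))%C) ->
  Cmod (csum F T) <= INR (length T) + Re (xi * csum (fun t => e_it (x * t)) T)%C.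
Proof.
  intros H. induction T as [|t T IH].
  - cbn. rewrite Cmod_0. lra.
  - cbn [length]. rewrite S_INR. simpl csum.
    eapply Rle_trans; [apply Cmod_triangle|]. specialize (H t).
    rewrite Cmult_plus_distr_l.
    change (Re (xi * e_it (x * t) + xi * csum (fun t0 => e_it (x * t0)) T))
      with (Re (xi * e_it (x * t)) + Re (xi * csum (fun t0 => e_it (x * t0)) T)).
    lra.
Qed.

Lemma npow_neg_axis (n : nat) (t : R) : npow_neg n (0, t) = e_it (- ln (INR n) * t).
Proof.
  unfold npow_neg, e_it. f_equal. unfold Cmult, RtoC; simpl. f_equal; ring.
Qed.

(* Take means of [sum_n b_n n^(-it)] against the nonnegative kernel
   [1 + Re (xi (m/n0)^(it))] of mean 1, translated to the frequency [log n0]: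
   only [b_n0], [b_m] and the coefficient of index [n0^2/m] survive. *)
Lemma bounded_dirichlet_coefficients (b : nat -> C) (G : R -> C) (n0 m : nat) :
  abs_summable b ->
  (forall t, is_series (dterm b (0, t)) (G t)) ->
  (forall t, Cmod (G t) <= 1) ->
  (0 < n0)%nat -> (0 < m)%nat -> n0 <> m ->
  (forall n, (0 < n)%nat -> (n * m = n0 * n0)%nat -> b n = 0%C) ->
  Cmod (b n0) + Cmod (b m) / 2 <= 1.
Proof.
  intros Hb HG HG1 Hn0 Hm Hnm Hbad.
  apply Rnot_lt_le; intros Hgt.
  (* The excess over 1 is [4 eps], while the three means below, with weights 1, 1/2 and 1/2, bring a
     total error of only [2 eps]. *)
  set (eps := (Cmod (b n0) + Cmod (b m) / 2 - 1) / 4).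
  assert (He : 0 < eps) by (unfold eps; lra).
  destruct (mean_coefficient (coef_abs b) eps) as [K HK];
    [apply coef_abs_nonneg | auto | auto |].
  set (u := reset0 b).
  assert (Hu : forall n, Cmod (u n) <= coef_abs b n)
    by (intros n; unfold u; rewrite Cmod_reset0; lra).
  (* [l3] is the reflection of [lm] in [l0], the logarithm of [n0^2/m]. *)
  set (l0 := ln (INR n0)). set (lm := ln (INR m)). set (l3 := 2 * l0 - lm).
  set (lam := fun (c : R) (n : nat) => c - ln (INR n)).
  assert (HF : forall c t, is_series (fun n => u n * e_it (lam c n * t))%C
                              (G t * e_it (c * t))%C).
  { intros c t. rewrite Cmult_comm.
    apply (is_series_C_ext (fun n => e_it (c * t) * dterm b (0, t)%R n)%C).
    - intros [|n]; unfold u, lam.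
      + simpl; ring.
      + cbn [dterm reset0]. rewrite npow_neg_axis.
        replace ((c - ln (INR (S n))) * t) with (c * t + - ln (INR (S n)) * t) by ring.
        rewrite e_it_plus. ring.
    - apply is_series_C_scal, HG. }
  assert (Hdec : forall n, (0 < n)%nat -> forall k, (0 < k)%nat -> n <> k ->
            ln (INR k) - ln (INR n) <> 0).
  { intros n Hn k Hk Hnk E. apply Hnk, INR_eq, ln_inv; try (apply lt_0_INR; auto). lra. }
  (* All frequencies of index below [K] seen from the three centres, and [lm - l0], whose
     annihilation gives the kernel mean 1. The zero ones are filtered out, since they cannot be
     averaged away. *)
  set (L0 := flat_map (fun n => [lam l0 n; lam lm n; lam l3 n]) (seq 0 K)
             ++ [lm - l0]).
  set (L := filter (fun x => if Req_EM_T x 0 then false else true) L0).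
  destruct (kill_frequencies L) as [T [HT HTL]].
  { intros x Hx. apply filter_In in Hx. destruct Hx as [_ Hx].
    destruct (Req_EM_T x 0); [discriminate|auto]. }
  assert (Hkill : forall x, In x L0 -> x <> 0 -> csum (fun t => e_it (x * t)) T = 0%C).
  { intros x Hx Hx0. apply HTL, filter_In; split; auto.
    destruct (Req_EM_T x 0); auto; contradiction. }
  assert (HL : forall c n, (n < K)%nat -> (c = l0 \/ c = lm \/ c = l3) ->
            In (lam c n) L0).
  { intros c n Hn Hc. apply in_or_app; left. apply in_flat_map. exists n; split.
    - apply in_seq; lia.
    - simpl. destruct Hc as [->|[->| ->]]; auto. }
  assert (P0 : 0 < INR (length T)) by (apply lt_0_INR; auto).
  assert (B1 : Cmod (csum (fun t => G t * e_it (l0 * t))%C T - b n0 * INR (length T))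
               <= INR (length T) * eps).
  { assert (H := HK u (lam l0) _ T n0 Hu (HF l0)).
    replace (b n0 * INR (length T))%C
      with (u n0 * csum (fun t => e_it (lam l0 n0 * t)) T)%C.
    - apply H. intros n Hn Hne. destruct n as [|n]; [left; reflexivity|right].
      apply Hkill; [apply HL; auto|]. apply Hdec; auto; lia.
    - f_equal; [destruct n0; [lia|reflexivity]|].
      rewrite <- csum_one. apply csum_ext. intros t. unfold lam, l0.
      rewrite Rminus_diag, Rmult_0_l. apply e_it_0. }
  assert (B2 : Cmod (csum (fun t => G t * e_it (lm * t))%C T - b m * INR (length T))
               <= INR (length T) * eps).
  { assert (H := HK u (lam lm) _ T m Hu (HF lm)).
    replace (b m * INR (length T))%C
      with (u m * csum (fun t => e_it (lam lm m * t)) T)%C.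
    - apply H. intros n Hn Hne. destruct n as [|n]; [left; reflexivity|right].
      apply Hkill; [apply HL; auto|]. apply Hdec; auto; lia.
    - f_equal; [destruct m; [lia|reflexivity]|].
      rewrite <- csum_one. apply csum_ext. intros t. unfold lam, lm.
      rewrite Rminus_diag, Rmult_0_l. apply e_it_0. }
  assert (B3 : Cmod (csum (fun t => G t * e_it (l3 * t))%C T)
               <= INR (length T) * eps).
  (* Index 0, where [u] vanishes, is taken as the distinguished one: no main term is expected, as
     the only positive index that can have frequency zero has coefficient zero by [Hbad]. *)
  { assert (H := HK u (lam l3) _ T 0%nat Hu (HF l3)).
    replace (csum (fun t => G t * e_it (l3 * t))%C T) with
      (csum (fun t => G t * e_it (l3 * t))%C T
        - u 0%nat * csum (fun t => e_it (lam l3 0%nat * t)) T)%C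
      by (simpl; ring).
    apply H. intros n Hn Hne. destruct (Req_dec (lam l3 n) 0) as [E|E].
    - left. destruct n as [|n]; [reflexivity|]. apply Hbad; [lia|].
      apply INR_eq. rewrite !mult_INR. apply ln_inv;
        try (apply Rmult_lt_0_compat; apply lt_0_INR; lia).
      rewrite !ln_mult by (apply lt_0_INR; lia). unfold lam, l3, l0, lm in E. lra.
    - right. apply Hkill; auto. }
  assert (B4 : csum (fun t => e_it ((lm - l0) * t)) T = 0%C).
  { apply Hkill; [apply in_or_app; right; left; auto|]. apply Hdec; auto. }
  destruct (align_phase (b n0) (b m / 2)%C) as [xi [Hxi Hal]].
  (* [F] is [G t * e_it (l0 * t)] times the kernel [1 + Re z], with [z = xi * e_it ((lm - l0) * t)],
     expanded into three exponentials by [Re z = (z + Cconj z) / 2]. *)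
  set (F := fun t => (G t * e_it (l0 * t)
     + (xi / 2 * (G t * e_it (lm * t))
        + Cconj xi / 2 * (G t * e_it (l3 * t))))%C).
  assert (HFk : forall t, Cmod (F t) <= 1 + Re (xi * e_it ((lm - l0) * t))%C).
  { intros t. set (z := (xi * e_it ((lm - l0) * t))%C).
    assert (Hz : Cmod z = 1) by (unfold z; rewrite Cmod_mult, Hxi, Cmod_e_it; ring).
    assert (Hrz := re_le_Cmod z). rewrite Hz in Hrz.
    assert (Hr0 : 0 <= 1 + Re z) by (generalize (Rabs_maj2 (Re z)); lra).
    replace (F t) with (G t * e_it (l0 * t) * RtoC (1 + Re z))%C.
    - rewrite !Cmod_mult, Cmod_e_it, Rmult_1_r, Cmod_R, Rabs_pos_eq by auto.
      rewrite <- (Rmult_1_l (1 + Re z)) at 2. apply Rmult_le_compat_r; auto.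
    - replace (RtoC (1 + Re z)) with (1 + (z + Cconj z) / 2)%C.
      2:{ rewrite RtoC_plus. f_equal. destruct z as [zx zy].
          unfold Cdiv, Cplus, Cmult, Cinv, Cconj, RtoC; simpl. f_equal; field. }
      unfold z, F. rewrite Cmult_conj, Cconj_e_it.
      replace (lm * t) with (l0 * t + (lm - l0) * t) by ring.
      replace (l3 * t) with (l0 * t + - ((lm - l0) * t)) by (unfold l3; ring).
      rewrite !e_it_plus. field. }
  assert (HM := Cmod_csum_kernel F xi (lm - l0) T HFk).
  rewrite B4 in HM. replace (xi * 0)%C with (RtoC 0) in HM by ring. simpl Re in HM.
  unfold F in HM. rewrite csum_plus, csum_plus, !csum_scal in HM.
  set (S1 := csum (fun t => G t * e_it (l0 * t))%C T) in *.
  set (S2 := csum (fun t => G t * e_it (lm * t))%C T) in *.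
  set (S3 := csum (fun t => G t * e_it (l3 * t))%C T) in *.
  set (N := INR (length T)) in *.
  assert (Hhalf : Cmod 2 = 2) by (rewrite Cmod_R, Rabs_pos_eq; lra).
  assert (H2 : RtoC 2 <> 0%C) by (intros H; apply RtoC_inj in H; lra).
  assert (E : (RtoC N * (b n0 + xi * (b m / 2)))%C =
     (S1 + (xi / 2 * S2 + Cconj xi / 2 * S3)
      - ((S1 - b n0 * N) + (xi / 2 * (S2 - b m * N) + Cconj xi / 2 * S3)))%C)
    by (field; auto).
  apply (f_equal Cmod) in E. rewrite Cmod_mult, Hal, Cmod_R, Rabs_pos_eq in E by lra.
  rewrite Cmod_div, Hhalf in E by auto.
  assert (Hle : N * (Cmod (b n0) + Cmod (b m) / 2)
    <= N + (N * eps + (1 / 2 * (N * eps) + 1 / 2 * (N * eps)))).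
  { rewrite E. eapply Rle_trans; [apply Cmod_triangle|]. rewrite Cmod_opp.
    apply Rplus_le_compat; [lra|].
    eapply Rle_trans; [apply Cmod_triangle|]. apply Rplus_le_compat; auto.
    eapply Rle_trans; [apply Cmod_triangle|].
    rewrite !Cmod_mult, !Cmod_div, Cmod_conj, Hxi, Hhalf by auto.
    apply Rplus_le_compat; apply Rmult_le_compat_l; auto; lra. }
  assert (Hfin : Cmod (b n0) + Cmod (b m) / 2 <= 1 + 2 * eps) by
    (apply Rmult_le_reg_l with N; auto; lra).
  unfold eps in Hfin. lra.
Qed.

(** The averaging takes place on the imaginary axis, where each term keeps the full modulus of its
    coefficient. Boundary values exist by absolute convergence, and right continuity carries the
    bound over to them. *)
Lemma bounded_halfplane_coefficients (b : nat -> C) (g : C -> C) (n0 m : nat) :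
  abs_summable b ->
  (forall s, 0 < Re s -> is_series (dterm b s) (g s)) ->
  (forall s, 0 < Re s -> Cmod (g s) <= 1) ->
  (0 < n0)%nat -> (0 < m)%nat -> n0 <> m ->
  (forall n, (0 < n)%nat -> (n * m = n0 * n0)%nat -> b n = 0%C) ->
  Cmod (b n0) + Cmod (b m) / 2 <= 1.
Proof.
  intros Hb Hg Hg1.
  assert (HG : exists G : R -> C, forall t, is_series (dterm b (0, t)) (G t)).
  { exists (fun t => iota (T := C_CompleteNormedModule)
              (fun l : C => is_series (dterm b (0, t)) l)).
    intros t. apply (iota_correct (V := C_CompleteNormedModule)
      (fun l : C => is_series (dterm b (0, t)) l)).
    destruct (dterm_converges b (0, t) Hb (Rle_refl 0)) as [l Hl].
    exists l; split; auto. intros l' Hl'. exact (is_series_C_unique _ _ _ Hl Hl'). }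
  destruct HG as [G HG].
  apply (bounded_dirichlet_coefficients b G n0 m Hb HG).
  intros t. apply Rnot_lt_le; intros Hgt.
  destruct (dirichlet_right_continuous b (0, t) (G t) ((Cmod (G t) - 1) / 2) Hb
              (Rle_refl 0) (HG t)) as [x [Hx Hc]]; [lra|].
  set (z := ((0, t) + RtoC x)%C).
  assert (Hz : 0 < Re z) by (simpl; lra).
  specialize (Hc x (g z) (conj Hx (Rle_refl x)) (Hg z Hz)).
  specialize (Hg1 z Hz).
  assert (T := Cmod_triangle (g z) (- (g z - G t))%C).
  replace (g z + - (g z - G t))%C with (G t) in T by ring.
  rewrite Cmod_opp in T. lra.
Qed.

(** * Behaviour at infinity *)

Lemma exp_decay_le (A B d x0 : R) :
  0 < d -> (forall x, x0 <= x -> A <= B * exp (- (d * x))) -> A <= 0.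
Proof.
  intros Hd H. apply Rnot_lt_le; intros HA.
  (* Past [B / A / d] the lower bound [1 + d * x] of [exp (d * x)] already exceeds [B / A]. *)
  set (x := Rmax x0 (Rmax 0 (B / A / d))).
  assert (H0 : 0 <= x) by (eapply Rle_trans; [apply Rmax_l | apply Rmax_r]).
  assert (HB : B / A / d <= x) by (eapply Rle_trans; [apply Rmax_r | apply Rmax_r]).
  specialize (H x (Rmax_l _ _)).
  assert (E := exp_ineq1_le (d * x)).
  assert (P := exp_pos (d * x)).
  rewrite exp_Ropp in H.
  assert (H1 : A * exp (d * x) <= B).
  { apply Rmult_le_compat_r with (r := exp (d * x)) in H; [|lra].
    replace (B * / exp (d * x) * exp (d * x)) with B in H by (field; lra). exact H. }
  assert (H2 : B <= A * (d * x)).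
  { replace B with (A * (d * (B / A / d))) by (field; lra).
    apply Rmult_le_compat_l; [lra|]. apply Rmult_le_compat_l; lra. }
  assert (A * (1 + d * x) <= A * exp (d * x)) by (apply Rmult_le_compat_l; lra).
  lra.
Qed.

Lemma sum_n_dterm_1 (a : nat -> C) (s : C) : sum_n (dterm a s) 1 = a 1%nat.
Proof.
  rewrite sum_Sn, sum_O. simpl dterm. rewrite npow_neg_1.
  change (0 + a 1%nat * 1 = a 1%nat)%C. ring.
Qed.

Lemma sum_n_dterm_2 (a : nat -> C) (s : C) :
  sum_n (dterm a s) 2 = (a 1%nat + a 2%nat * npow_neg 2 s)%C.
Proof. rewrite sum_Sn, sum_n_dterm_1. reflexivity. Qed.

Lemma Aplus_asymptotic_2 (a : nat -> C) :
  abs_summable a -> exists M, 0 <= M /\ forall s l, 0 <= Re s -> is_series (dterm a s) l ->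
    Cmod (l - (a 1%nat + a 2%nat * npow_neg 2 s)) <= M * exp (- ln 3 * Re s).
Proof.
  intros Ha. exists (Series (coef_abs a)); split.
  - apply Series_nonneg; auto. apply coef_abs_nonneg.
  - intros s l Hs Hl. rewrite <- sum_n_dterm_2.
    replace 3 with (INR 3) by (simpl; ring). apply dirichlet_asymptotic; auto.
Qed.

Lemma abs_summable_inv_square (a : nat -> C) (B : R) :
  (forall n, Cmod (a (S n)) <= B * / (INR (S n) * INR (S n))) -> abs_summable a.
Proof.
  intros H.
  assert (HB : 0 <= B).
  { specialize (H 0%nat). simpl in H. assert (Z := Cmod_ge_0 (a 1%nat)). lra. }
  apply (ex_series_bounded (coef_abs a) (B * 2)); [apply coef_abs_nonneg|].
  (* The term [- / INR (S n)] makes the induction telescope. *)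
  assert (HS : forall n, sum_n (coef_abs a) (S n) <= B * (2 - / INR (S n))).
  { induction n as [|n IH].
    - rewrite sum_Sn, sum_O. specialize (H 0%nat). cbn in *. unfold plus; simpl. lra.
    - rewrite sum_Sn. eapply Rle_trans.
      { apply Rplus_le_compat; [exact IH | exact (H (S n))]. }
      rewrite <- Rmult_plus_distr_l. apply Rmult_le_compat_l; auto.
      rewrite (S_INR (S n)). assert (P : 0 < INR (S n)) by (apply lt_0_INR; lia).
      set (x := INR (S n)) in *.
      assert (E : / x - / (x + 1) - / ((x + 1) * (x + 1)) = / (x * ((x + 1) * (x + 1))))
        by (field; lra).
      assert (0 < / (x * ((x + 1) * (x + 1)))).
      { apply Rinv_0_lt_compat. repeat apply Rmult_lt_0_compat; lra. }
      lra. }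
  intros [|n].
  - rewrite sum_O. simpl. lra.
  - eapply Rle_trans; [apply HS|]. apply Rmult_le_compat_l; auto.
    assert (0 < / INR (S n)) by (apply Rinv_0_lt_compat, lt_0_INR; lia). lra.
Qed.

(** Membership in D gives mere convergence, hence only bounded terms at [theta + 1]. Moving two
    units to the right gains a factor [n^(-2)], so the series converges absolutely at [theta + 3];
    recentred there, it has summable coefficients. *)
Lemma in_D_asymptotic (f : C -> C) :
  in_D f -> exists (c1 c2 : C) (M sigma : R), 0 <= M /\ 0 < sigma /\
    forall s, sigma <= Re s ->
      Cmod (f s - (c1 + c2 * npow_neg 2 s)) <= M * exp (- ln 3 * Re s).
Proof.
  intros [_ [c [theta Hc]]].
  set (s0 := RtoC (theta + 1)). set (s1 := RtoC (theta + 3)).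
  assert (H0 : is_series (dterm c s0) (f s0)) by (apply Hc; simpl; lra).
  destruct (filterlim_bounded (sum_n (dterm c s0))) as [B HB];
    [exists (f s0); exact H0|].
  set (a := fun n => (c n * npow_neg n s1)%C).
  assert (Ha : abs_summable a).
  { apply (abs_summable_inv_square a (2 * B)). intros n.
    assert (E : dterm c s0 (S n) = (sum_n (dterm c s0) (S n) - sum_n (dterm c s0) n)%C).
    { rewrite sum_Sn. unfold plus; simpl. ring. }
    assert (T := Cmod_triangle (sum_n (dterm c s0) (S n)) (- sum_n (dterm c s0) n)).
    rewrite Cmod_opp in T. unfold Cminus in E. rewrite <- E in T.
    assert (B1 : Cmod (sum_n (dterm c s0) n) <= B) by exact (HB n).
    assert (B2 : Cmod (sum_n (dterm c s0) (S n)) <= B) by exact (HB (S n)).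
    unfold a, s1. replace (RtoC (theta + 3)) with (s0 + RtoC 2)%C
      by (unfold s0; rewrite <- RtoC_plus; f_equal; ring).
    rewrite npow_neg_plus, Cmult_assoc, Cmod_mult, npow_neg_real_shift.
    assert (P : 0 < INR (S n)) by (apply lt_0_INR; lia).
    replace (exp (- ln (INR (S n)) * 2)) with (/ (INR (S n) * INR (S n))).
    2:{ replace (- ln (INR (S n)) * 2) with (- (ln (INR (S n)) + ln (INR (S n)))) by ring.
        rewrite exp_Ropp, exp_plus, exp_ln by auto. reflexivity. }
    assert (Q : 0 < / (INR (S n) * INR (S n)))
      by (apply Rinv_0_lt_compat, Rmult_lt_0_compat; auto).
    rewrite Cmod_R, (Rabs_pos_eq (/ _)) by lra.
    apply Rmult_le_compat_r; [lra|]. cbn [dterm] in T. lra. }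
  assert (Hda : forall s n, dterm c s n = dterm a (s - s1) n).
  { intros s [|n]; [reflexivity|]. cbn [dterm]. unfold a.
    rewrite <- Cmult_assoc, <- npow_neg_plus. do 2 f_equal. ring. }
  set (S := Series (coef_abs a)).
  assert (HS : 0 <= S) by (apply Series_nonneg; auto; apply coef_abs_nonneg).
  (* The factor [3^(theta+3)] undoes the recentring at [s1]. *)
  exists (c 1%nat), (c 2%nat), (S * exp (ln 3 * (theta + 3))), (Rmax (theta + 3) 1).
  split; [|split].
  - apply Rmult_le_pos; auto. left; apply exp_pos.
  - eapply Rlt_le_trans; [apply Rlt_0_1 | apply Rmax_r].
  - intros s Hs. assert (Hs1 : theta + 3 <= Re s) by (eapply Rle_trans; [apply Rmax_l|exact Hs]).
    rewrite <- sum_n_dterm_2.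
    rewrite (sum_n_ext _ _ 2 (Hda s)).
    assert (Hr : Re (s - s1) = Re s - (theta + 3)) by (destruct s; simpl; ring).
    rewrite Rmult_assoc, <- exp_plus.
    replace (ln 3 * (theta + 3) + - ln 3 * Re s) with (- ln (INR 3) * Re (s - s1)).
    2:{ rewrite Hr. replace (INR 3) with 3 by (simpl; ring). ring. }
    apply dirichlet_asymptotic; auto; [rewrite Hr; lra|].
    apply (is_series_C_ext (dterm c s)); auto. apply Hc. lra.
Qed.

(** * Functions with constant n^(-h) *)

Lemma holomorphic_continuous (h : C -> C) (s : C) (eps : R) :
  holomorphic_C0 h -> 0 < Re s -> 0 < eps ->
  exists delta, 0 < delta /\ forall t, Cmod (t - s) < delta -> Cmod (h t - h s) < eps.
Proof.
  intros Hh Hs He.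
  assert (Hc := ex_derive_continuous (K := C_AbsRing) (V := C_NormedModule) h s (Hh s Hs)).
  assert (Hb := proj1 (filterlim_locally_ball_norm h (h s)) Hc (mkposreal eps He)).
  destruct Hb as [d Hd]. exists d; split; [apply cond_pos|].
  intros t Ht. exact (Hd t Ht).
Qed.

(** A constant value of [2^(-h)] fixes [Re h] and determines [Im h] up to multiples of
    [2 pi / ln 2]. If [Im h] took two values, the intermediate value theorem on the segment between
    the points would yield a third one, different from the first by less than [pi / ln 2]. *)
Lemma constant_of_npow_neg (h : C -> C) (k : C) :
  holomorphic_C0 h -> (forall s, 0 < Re s -> npow_neg 2 (h s) = k) ->
  forall s s', 0 < Re s -> 0 < Re s' -> h s = h s'.
Proof.
  intros Hh Hk s s' Hs Hs'.
  assert (L2 : 0 < ln 2) by (generalize ln_lt_2; lra).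
  assert (N2 : INR 2 = 2) by (simpl; ring).
  assert (HRe : forall u v, 0 < Re u -> 0 < Re v -> Re (h u) = Re (h v)).
  { intros u v Hu Hv. assert (E : Cmod (npow_neg 2 (h u)) = Cmod (npow_neg 2 (h v)))
      by (rewrite !Hk; auto).
    rewrite !Cmod_npow_neg, N2 in E. apply exp_inv in E. nra. }
  set (p := fun x : R => (s + RtoC x * (s' - s))%C).
  set (psi := fun x => Im (h (p x))).
  assert (P0 : p 0 = s) by (unfold p; ring).
  assert (P1 : p 1 = s') by (unfold p; ring).
  assert (Hp : forall x, 0 <= x <= 1 -> 0 < Re (p x)).
  { intros x Hx. replace (Re (p x)) with ((1 - x) * Re s + x * Re s')
      by (unfold p, Re; simpl; ring).
    destruct (Rle_dec x (1/2)); nra. }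
  assert (Hpsi : forall x, 0 <= x <= 1 -> forall eps, 0 < eps ->
     exists d, 0 < d /\ forall y, Rabs (y - x) < d -> Rabs (psi y - psi x) < eps).
  { intros x Hx eps He.
    destruct (holomorphic_continuous h (p x) eps Hh (Hp x Hx) He) as [d [Hd Hc]].
    assert (Hq := Cmod_ge_0 (s' - s)).
    exists (d / (Cmod (s' - s) + 1)); split; [apply Rdiv_lt_0_compat; lra|].
    intros y Hy. eapply Rle_lt_trans; [|apply (Hc (p y))].
    - replace (psi y - psi x) with (Im (h (p y) - h (p x)))
        by (unfold psi; destruct (h (p y)), (h (p x)); reflexivity).
      eapply Rle_trans; [apply Rmax_r | apply Rmax_Cmod].
    - replace (p y - p x)%C with (RtoC (y - x) * (s' - s))%C
        by (unfold p; rewrite RtoC_minus; ring).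
      rewrite Cmod_mult, Cmod_R.
      apply Rlt_div_r in Hy; [|lra].
      assert (0 <= Rabs (y - x)) by apply Rabs_pos. nra. }
  destruct (Req_dec (psi 1) (psi 0)) as [E|E].
  { unfold psi in E. rewrite P0, P1 in E.
    assert (R1 := HRe s s' Hs Hs').
    apply injective_projections; [exact R1 | symmetry; exact E]. }
  exfalso. set (d := psi 1 - psi 0). assert (Hd : d <> 0) by (unfold d; lra).
  assert (Pd : 0 < Rabs d) by (apply Rabs_pos_lt; auto).
  assert (PP := PI_RGT_0).
  (* A fraction of the jump [d], strictly between 0 and 1, for which the phase [ln 2 * (r * d)]
     stays inside [(-pi, pi)] and so has a nonzero sine. *)
  set (r := PI / (Rabs d * ln 2 + PI)).
  assert (Q : 0 < Rabs d * ln 2) by (apply Rmult_lt_0_compat; auto).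
  assert (Hr : 0 < r < 1).
  { split; [apply Rdiv_lt_0_compat; lra|]. unfold r. apply Rlt_div_l; lra. }
  assert (HrPI : Rabs d * ln 2 * r < PI).
  { unfold r. apply Rmult_lt_reg_r with (Rabs d * ln 2 + PI); [lra|].
    replace (Rabs d * ln 2 * (PI / (Rabs d * ln 2 + PI)) * (Rabs d * ln 2 + PI))
      with (Rabs d * ln 2 * PI) by (field; lra). nra. }
  assert (D2 : 0 < d * d) by nra.
  (* The factor [d] makes the function rise from negative to positive whatever the sign of [d]. *)
  destruct (Ranalysis5.IVT_interv (fun x => (psi x - psi 0 - r * d) * d) 0 1) as [x [Hx Hz]].
  - intros x Hx eps He.
    destruct (Hpsi x Hx (eps / Rabs d)) as [e [He0 Hc]]; [apply Rdiv_lt_0_compat; auto|].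
    exists e; split; auto. intros y [_ Hy].
    change (Rabs ((psi y - psi 0 - r * d) * d - (psi x - psi 0 - r * d) * d) < eps).
    replace ((psi y - psi 0 - r * d) * d - (psi x - psi 0 - r * d) * d)
      with ((psi y - psi x) * d) by ring.
    rewrite Rabs_mult. apply Rlt_div_r; auto.
  - lra.
  - replace ((psi 0 - psi 0 - r * d) * d) with (- (r * (d * d))) by ring.
    assert (0 < r * (d * d)) by (apply Rmult_lt_0_compat; lra). lra.
  - replace ((psi 1 - psi 0 - r * d) * d) with ((1 - r) * (d * d)) by (unfold d; ring).
    apply Rmult_lt_0_compat; lra.
  - apply Rmult_integral in Hz. destruct Hz as [Hz|Hz]; [|contradiction].
    assert (Hpsix : psi x = psi 0 + r * d) by lra.
    assert (K : npow_neg 2 (h (p x)) = npow_neg 2 (h s)) by (rewrite !Hk; auto).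
    assert (Ex : h (p x) = (h s + (0, (r * d)%R))%C).
    { assert (R1 := HRe _ _ (Hp x Hx) Hs). unfold psi in Hpsix. rewrite P0 in Hpsix.
      apply injective_projections; [|exact Hpsix].
      unfold Re in R1. simpl. lra. }
    rewrite Ex, npow_neg_plus, npow_neg_axis, N2 in K.
    assert (K1 : e_it (- ln 2 * (r * d)) = 1%C).
    { assert (NZ : npow_neg 2 (h s) <> 0%C) by apply cexp_neq_0.
      set (w := e_it _) in *.
      replace w with (npow_neg 2 (h s) * w / npow_neg 2 (h s))%C by (field; auto).
      rewrite K. field; auto. }
    apply (f_equal Im) in K1. unfold e_it, cexp in K1; simpl in K1.
    rewrite exp_0, Rmult_1_l in K1.
    replace (- ln 2 * (r * d)) with (- (ln 2 * (r * d))) in K1 by ring.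
    rewrite sin_neg in K1.
    destruct (Rcase_abs d) as [Hn|Hn].
    + rewrite Rabs_left in HrPI by auto.
      assert (G : 0 < sin (- (ln 2 * (r * d)))).
      { apply sin_gt_0; [|lra].
        replace (- (ln 2 * (r * d))) with (ln 2 * (r * (- d))) by ring.
        apply Rmult_lt_0_compat; auto. apply Rmult_lt_0_compat; lra. }
      rewrite sin_neg in G. lra.
    + rewrite Rabs_right in HrPI by auto.
      assert (G : 0 < sin (ln 2 * (r * d))).
      { apply sin_gt_0; [|lra].
        apply Rmult_lt_0_compat; auto. apply Rmult_lt_0_compat; lra. }
      lra.
Qed.

(** * Second order Taylor expansion *)

Lemma exp_minus_1_bound (x : R) : Rabs (exp x - 1) <= Rabs x * exp (Rabs x).
Proof.
  assert (H1 := exp_ineq1_le x). assert (H2 := exp_ge_1_minus x).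
  assert (P := exp_pos x). rewrite exp_Ropp in H2.
  assert (H3 : exp x - 1 <= x * exp x).
  { apply Rmult_le_compat_r with (r := exp x) in H2; [|lra].
    replace (/ exp x * exp x) with 1 in H2 by (field; lra). lra. }
  destruct (Rle_dec 0 x) as [H|H].
  - rewrite !Rabs_pos_eq; lra.
  - rewrite (Rabs_left x) by lra.
    assert (exp x <= 1) by (rewrite <- exp_0; apply exp_le_compat; lra).
    assert (1 <= exp (- x)) by (rewrite <- exp_0; apply exp_le_compat; lra).
    rewrite Rabs_left1 by lra. nra.
Qed.

Lemma exp_taylor_bound (x : R) : Rabs (exp x - 1 - x) <= x * x * exp (Rabs x).
Proof.
  assert (H1 := exp_ineq1_le x). assert (H2 := exp_ge_1_minus x).
  assert (P := exp_pos x). rewrite exp_Ropp in H2.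
  assert (H3 : exp x - 1 <= x * exp x).
  { apply Rmult_le_compat_r with (r := exp x) in H2; [|lra].
    replace (/ exp x * exp x) with 1 in H2 by (field; lra). lra. }
  rewrite Rabs_pos_eq by lra.
  assert (H4 := exp_minus_1_bound x).
  assert (H5 : x * (exp x - 1) <= Rabs x * Rabs (exp x - 1))
    by (rewrite <- Rabs_mult; apply Rle_abs).
  assert (H6 : Rabs x * Rabs (exp x - 1) <= Rabs x * (Rabs x * exp (Rabs x)))
    by (apply Rmult_le_compat_l; [apply Rabs_pos | auto]).
  rewrite <- Rmult_assoc, <- (Rabs_mult x x), (Rabs_pos_eq (x * x)) in H6 by nra. lra.
Qed.

Lemma sin_abs_le (y : R) : Rabs (sin y) <= Rabs y.
Proof.
  assert (G : forall x, 0 < x -> Rabs (sin x) <= x).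
  { intros x Hx. apply Rabs_le; split; [|left; apply sin_lt_x; auto].
    destruct (Rle_dec x 1) as [H|H].
    - assert (0 < sin x) by (apply sin_gt_0; generalize PI2_1; lra). lra.
    - generalize (SIN_bound x); lra. }
  destruct (Rtotal_order y 0) as [H|[->|H]].
  - rewrite (Rabs_left y), <- Rabs_Ropp, <- sin_neg by lra. apply G; lra.
  - rewrite sin_0; lra.
  - rewrite (Rabs_right y) by lra. apply G; auto.
Qed.

Lemma cos_minus_1_bound (y : R) : 0 <= 1 - cos y <= y * y / 2.
Proof.
  split; [generalize (COS_bound y); lra|].
  replace (cos y) with (cos (2 * (y / 2))) by (f_equal; field).
  rewrite cos_2a_sin.
  assert (H := sin_abs_le (y / 2)). apply Rsqr_le_abs_1 in H. unfold Rsqr in H. lra.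
Qed.

Lemma sin_taylor_bound (y : R) : Rabs (sin y - y) <= y * y.
Proof.
  destruct (MVT_gen (fun x => sin x - x) 0 y (fun x => cos x - 1)) as [c [Hc E]].
  - intros x _. auto_derive; auto; ring.
  - intros x _. apply continuity_pt_minus; [apply continuity_sin | apply derivable_continuous_pt, derivable_pt_id].
  - rewrite sin_0 in E. replace (sin y - y) with ((cos c - 1) * y) by lra.
    rewrite Rabs_mult, <- (Rabs_pos_eq (y * y)), Rabs_mult by nra.
    apply Rmult_le_compat_r; [apply Rabs_pos|].
    apply Rle_trans with (Rabs c).
    + assert (H := cos_minus_1_bound c). assert (H' := COS_bound c).
      rewrite Rabs_left1 by lra.
      assert (E2 : c * c = Rabs c * Rabs c) by (rewrite <- Rabs_mult, Rabs_pos_eq; nra).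
      assert (Hp := Rabs_pos c). destruct (Rle_dec (Rabs c) 2); nra.
    + unfold Rmin, Rmax in Hc. destruct (Rle_dec 0 y).
      * rewrite !Rabs_pos_eq; lra.
      * rewrite !Rabs_left1; lra.
Qed.

Lemma Cmod_le_Rabs (z : C) : Cmod z <= Rabs (Re z) + Rabs (Im z).
Proof.
  destruct z as [x y]. replace ((x, y) : C) with (RtoC x + Ci * RtoC y)%C.
  - eapply Rle_trans; [apply Cmod_triangle|]. rewrite Cmod_mult, Cmod_Ci, !Cmod_R. simpl.
    replace (x + (0 * y - 1 * 0)) with x by ring.
    replace (0 + (0 * 0 + 1 * y)) with y by ring. lra.
  - unfold Cplus, Cmult, Ci, RtoC; simpl; f_equal; ring.
Qed.

(** The real and the imaginary part each contribute [2 * (r * r * E)], with [r = Cmod z] and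
    [E = exp r]. *)
Lemma cexp_taylor_bound (z : C) :
  Cmod (cexp z - 1 - z) <= 4 * (Cmod z * Cmod z) * exp (Cmod z).
Proof.
  set (r := Cmod z). set (E := exp r).
  assert (Hr : 0 <= r) by apply Cmod_ge_0.
  assert (Hx : Rabs (Re z) <= r) by apply re_le_Cmod.
  assert (Hy : Rabs (Im z) <= r) by (eapply Rle_trans; [apply Rmax_r | apply Rmax_Cmod]).
  eapply Rle_trans; [apply Cmod_le_Rabs|].
  destruct z as [x y]. simpl in Hx, Hy. unfold cexp; simpl.
  assert (HE : 1 <= E) by (unfold E; rewrite <- exp_0; apply exp_le_compat; auto).
  assert (Ex : exp (Rabs x) <= E) by (apply exp_le_compat; auto).
  assert (Ex' : exp x <= E) by (apply exp_le_compat; generalize (Rle_abs x); lra).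
  assert (P := exp_pos x). assert (P' := exp_pos (Rabs x)).
  assert (Px := Rabs_pos x). assert (Py := Rabs_pos y).
  assert (X2 : x * x <= r * r) by (rewrite <- (Rabs_pos_eq (x * x)), Rabs_mult by nra; nra).
  assert (Y2 : y * y <= r * r) by (rewrite <- (Rabs_pos_eq (y * y)), Rabs_mult by nra; nra).
  assert (B1 : Rabs (exp x - 1 - x) <= r * r * E).
  { eapply Rle_trans; [apply exp_taylor_bound|]. apply Rmult_le_compat; nra. }
  assert (B2 : Rabs (exp x - 1) <= r * E).
  { eapply Rle_trans; [apply exp_minus_1_bound|]. apply Rmult_le_compat; lra. }
  assert (B3 := cos_minus_1_bound y).
  assert (B4 : Rabs (sin y) <= r) by (eapply Rle_trans; [apply sin_abs_le|auto]).
  assert (B5 := sin_taylor_bound y).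
  assert (C1 : Rabs (exp x * cos y + - (1) + - x) <= 2 * (r * r * E)).
  { replace (exp x * cos y + - (1) + - x) with ((exp x - 1 - x) - exp x * (1 - cos y)) by ring.
    eapply Rle_trans; [apply Rabs_triang|]. rewrite Rabs_Ropp, (Rabs_pos_eq (exp x * _)).
    - assert (exp x * (1 - cos y) <= E * (r * r)) by (apply Rmult_le_compat; lra). lra.
    - apply Rmult_le_pos; lra. }
  assert (C2 : Rabs (exp x * sin y + - 0 + - y) <= 2 * (r * r * E)).
  { replace (exp x * sin y + - 0 + - y) with ((exp x - 1) * sin y + (sin y - y)) by ring.
    eapply Rle_trans; [apply Rabs_triang|]. rewrite Rabs_mult.
    assert (Rabs (exp x - 1) * Rabs (sin y) <= r * E * r)
      by (apply Rmult_le_compat; auto; apply Rabs_pos).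
    assert (r * r * 1 <= r * r * E) by (apply Rmult_le_compat_l; nra). lra. }
  lra.
Qed.

Lemma mul_exp_neg_bound (r x : R) : 0 < r -> 0 <= x -> x * exp (- (r * x)) <= / r.
Proof.
  intros Hr Hx. assert (H := exp_ineq1_le (r * x)). assert (P := exp_pos (r * x)).
  rewrite exp_Ropp. apply Rmult_le_reg_r with (r * exp (r * x)); [nra|].
  replace (x * / exp (r * x) * (r * exp (r * x))) with (r * x) by (field; lra).
  replace (/ r * (r * exp (r * x))) with (exp (r * x)) by (field; lra). lra.
Qed.

Lemma sqr_mul_exp_neg_bound (r x : R) :
  0 < r -> 0 <= x -> x * x * exp (- (r * x)) <= / (r / 2) * / (r / 2).
Proof.
  intros Hr Hx.
  assert (H := mul_exp_neg_bound (r / 2) x ltac:(lra) Hx).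
  assert (P := exp_pos (- (r / 2 * x))).
  replace (exp (- (r * x))) with (exp (- (r / 2 * x)) * exp (- (r / 2 * x)))
    by (rewrite <- exp_plus; f_equal; field).
  replace (x * x * (exp (- (r / 2 * x)) * exp (- (r / 2 * x))))
    with ((x * exp (- (r / 2 * x))) * (x * exp (- (r / 2 * x)))) by ring.
  assert (0 <= x * exp (- (r / 2 * x))) by nra.
  apply Rmult_le_compat; auto.
Qed.

(** [D] is the termwise derivative at [c]. On the disc of radius [Re c / 2] half of the decay
    [n^(-Re c)] survives, which absorbs the factor [(ln n)^2] of the second order remainder
    uniformly in [n]. *)
Lemma Aplus_taylor (f : C -> C) (c : C) :
  in_Aplus f -> 0 < Re c ->
  exists (D : C) (M : R), 0 <= M /\
    forall w, Cmod (w - c) <= Re c / 2 ->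
      Cmod (f w - f c - D * (w - c)) <= M * (Cmod (w - c) * Cmod (w - c)).
Proof.
  intros [a [Ha Hf]] Hc.
  set (d := fun n => (RtoC (- ln (INR n)) * dterm a c n)%C).
  assert (Hd : exists D : C, is_series d D).
  { apply (ex_series_C_abs d (fun n => / Re c * coef_abs a n)).
    - exact (ex_series_scal_l (/ Re c) _ Ha).
    - intros n. unfold d. rewrite Cmod_mult, Cmod_R, Rabs_Ropp, Rabs_pos_eq
        by apply ln_INR_nonneg.
      rewrite Cmod_dterm.
      assert (H := mul_exp_neg_bound (Re c) (ln (INR n)) Hc (ln_INR_nonneg n)).
      replace (- ln (INR n) * Re c) with (- (Re c * ln (INR n))) by ring.
      assert (H0 := coef_abs_nonneg a n). nra. }
  destruct Hd as [D HD]. set (r := Re c / 2). set (B := / (r / 2) * / (r / 2)).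
  assert (Hr : 0 < r) by (unfold r; lra).
  assert (HB : 0 <= B).
  { assert (0 < / (r / 2)) by (apply Rinv_0_lt_compat; lra). unfold B; nra. }
  set (S := Series (coef_abs a)).
  assert (HS : 0 <= S) by (apply Series_nonneg; auto; apply coef_abs_nonneg).
  exists D, (4 * B * S); split; [nra|].
  intros w Hw. set (q := Cmod (w - c)) in *. assert (Hq : 0 <= q) by apply Cmod_ge_0.
  assert (Hw0 : 0 <= Re w).
  { assert (H := re_le_Cmod (w - c)). fold q in H.
    replace (Re (w - c)) with (Re w - Re c) in H by (destruct w, c; simpl; ring).
    apply Rabs_le_between in H. unfold r in Hw; lra. }
  replace (4 * B * S * (q * q)) with (Series (fun n => (4 * B * (q * q)) * coef_abs a n))
    by (rewrite Series_scal_l; unfold S; ring).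
  apply (is_series_C_Cmod_le
    (fun n => dterm a w n - dterm a c n - (w - c) * d n)%C).
  - rewrite (Cmult_comm D). apply is_series_C_minus; [apply is_series_C_minus|].
    + apply Hf; auto.
    + apply Hf; lra.
    + apply is_series_C_scal; auto.
  - exact (ex_series_scal_l _ _ Ha).
  - intros n.
    set (L := ln (INR n)). assert (HL : 0 <= L) by apply ln_INR_nonneg.
    set (z := (RtoC (- L) * (w - c))%C).
    assert (Hz : Cmod z = L * q).
    { unfold z. rewrite Cmod_mult, Cmod_R, Rabs_Ropp, Rabs_pos_eq; auto. }
    replace (dterm a w n - dterm a c n - (w - c) * d n)%C
      with (dterm a c n * (cexp z - 1 - z))%C.
    2:{ unfold d. fold L. destruct n as [|n]; [simpl; ring|]. cbn [dterm].
        replace w with (c + (w - c))%C at 1 by ring. rewrite npow_neg_plus.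
        change (npow_neg (Datatypes.S n) (w - c)) with (cexp z). unfold z. ring. }
    rewrite Cmod_mult, Cmod_dterm. fold L.
    assert (T := cexp_taylor_bound z). rewrite Hz in T.
    assert (A0 := coef_abs_nonneg a n).
    assert (P := exp_pos (- L * Re c)).
    replace (4 * B * (q * q) * coef_abs a n)
      with (coef_abs a n * (4 * (q * q) * B)) by ring.
    rewrite Rmult_assoc. apply Rmult_le_compat_l; auto.
    apply Rle_trans with (exp (- L * Re c) * (4 * (L * q * (L * q)) * exp (L * q))).
    { apply Rmult_le_compat_l; lra. }
    replace (exp (- L * Re c) * (4 * (L * q * (L * q)) * exp (L * q)))
      with (4 * (q * q) * (L * L * (exp (- L * Re c) * exp (L * q)))) by ring.
    apply Rmult_le_compat_l; [nra|].
    rewrite <- exp_plus.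
    eapply Rle_trans; [|apply (sqr_mul_exp_neg_bound r L Hr HL)].
    apply Rmult_le_compat_l; [nra|]. apply exp_le_compat. unfold r in *. nra.
Qed.

(** * Comparison of the scales 2^(-x), 3^(-x) and 4^(-x) *)

Definition neg_pow2 (x : R) : R := exp (- ln 2 * x).
Definition neg_pow3 (x : R) : R := exp (- ln 3 * x).

Lemma Cmod_npow_neg_2 (s : C) : Cmod (npow_neg 2 s) = neg_pow2 (Re s).
Proof. rewrite Cmod_npow_neg. unfold neg_pow2. do 4 f_equal. Qed.

Lemma Cmod_npow_neg_3 (s : C) : Cmod (npow_neg 3 s) = neg_pow3 (Re s).
Proof. rewrite Cmod_npow_neg. unfold neg_pow3. do 4 f_equal. simpl; ring. Qed.

(** These gaps separate the scales: [3^(-x)] is negligible against [2^(-x)], and [(2^(-x))^2], the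
    size of quadratic errors, against [3^(-x)]. *)
Lemma ln2_lt_ln3 : 0 < ln 2 /\ ln 2 < ln 3 /\ ln 3 < 2 * ln 2.
Proof.
  split; [generalize ln_lt_2; lra|]. split; [apply ln_increasing; lra|].
  replace (2 * ln 2) with (ln 4); [apply ln_increasing; lra|].
  replace 4 with (2 * 2) by ring. rewrite ln_mult by lra. ring.
Qed.

Lemma neg_pow2_pos (x : R) : 0 < neg_pow2 x.
Proof. apply exp_pos. Qed.

Lemma neg_pow3_pos (x : R) : 0 < neg_pow3 x.
Proof. apply exp_pos. Qed.

Lemma neg_pow2_le_1 (x : R) : 0 <= x -> neg_pow2 x <= 1.
Proof.
  intros Hx. unfold neg_pow2. rewrite <- exp_0. apply exp_le_compat.
  generalize ln2_lt_ln3; nra.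
Qed.

Lemma neg_pow3_le_pow2 (x : R) : 0 <= x -> neg_pow3 x <= neg_pow2 x.
Proof. intros Hx. apply exp_le_compat. generalize ln2_lt_ln3; nra. Qed.

Lemma neg_pow2_sqr_le_pow3 (x : R) : 0 <= x -> neg_pow2 x * neg_pow2 x <= neg_pow3 x.
Proof.
  intros Hx. unfold neg_pow2, neg_pow3. rewrite <- exp_plus. apply exp_le_compat.
  generalize ln2_lt_ln3; nra.
Qed.

Lemma neg_pow2_mul_le (x y : R) : 0 <= x -> 1 <= y -> neg_pow2 (y * x) <= neg_pow2 x.
Proof.
  intros Hx Hy. assert (L := ln2_lt_ln3). apply exp_le_compat.
  assert (x <= y * x) by nra. nra.
Qed.

Lemma neg_pow3_mul_le (x y : R) : 0 <= x -> 1 <= y -> neg_pow3 (y * x) <= neg_pow3 x.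
Proof.
  intros Hx Hy. assert (L := ln2_lt_ln3). apply exp_le_compat.
  assert (x <= y * x) by nra. nra.
Qed.

Lemma le_pow2_nonpos (A B x0 : R) : (forall x, x0 <= x -> A <= B * neg_pow2 x) -> A <= 0.
Proof.
  intros H. apply (exp_decay_le A B (ln 2) x0); [apply ln2_lt_ln3|].
  intros x Hx. replace (- (ln 2 * x)) with (- ln 2 * x) by ring. apply H; auto.
Qed.

Lemma neg_pow2_le_pow3_nonpos (A B x0 : R) :
  (forall x, x0 <= x -> A * neg_pow2 x <= B * neg_pow3 x) -> A <= 0.
Proof.
  intros H. assert (L := ln2_lt_ln3).
  apply (exp_decay_le A B (ln 3 - ln 2) x0); [lra|].
  intros x Hx. apply Rmult_le_reg_r with (neg_pow2 x); [apply neg_pow2_pos|].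
  rewrite Rmult_assoc. unfold neg_pow2 at 2. rewrite <- exp_plus.
  replace (- ((ln 3 - ln 2) * x) + - ln 2 * x) with (- ln 3 * x) by ring.
  apply H; auto.
Qed.

Lemma neg_pow3_le_pow2_sqr_nonpos (A B x0 : R) :
  (forall x, x0 <= x -> A * neg_pow3 x <= B * (neg_pow2 x * neg_pow2 x)) -> A <= 0.
Proof.
  intros H. assert (L := ln2_lt_ln3).
  apply (exp_decay_le A B (2 * ln 2 - ln 3) x0); [lra|].
  intros x Hx. apply Rmult_le_reg_r with (neg_pow3 x); [apply neg_pow3_pos|].
  rewrite Rmult_assoc. unfold neg_pow3 at 2. rewrite <- exp_plus.
  replace (- ((2 * ln 2 - ln 3) * x) + - ln 3 * x) with (- ln 2 * x + - ln 2 * x) by ring.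
  rewrite exp_plus. apply H; auto.
Qed.

Lemma Cmod_le_0 (z : C) : Cmod z <= 0 -> z = 0%C.
Proof. intros H. apply Cmod_eq_0, Rle_antisym; [auto | apply Cmod_ge_0]. Qed.

Lemma Cmod_le_minus (z w : C) : Cmod z <= Cmod w + Cmod (z - w).
Proof.
  assert (T := Cmod_triangle w (z - w)).
  replace (w + (z - w))%C with z in T by ring. exact T.
Qed.

Lemma Cmod_minus_sym (z w : C) : Cmod (z - w) = Cmod (w - z).
Proof. rewrite <- Cmod_opp. f_equal. ring. Qed.

(** * The case c0 = 0 *)

(** If [Re c1 <= 0], then [Re (phi s)] is squeezed to 0, so [|2^(-phi)|] tends to 1 and
    [|b_1| >= 1]. The coefficient inequality with [n0 = 1] then kills every other [b_m], so
    [2^(-phi)], and with it [phi], is constant. *)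
Lemma limit_in_C0 (phi : C -> C) (c1 : C) (M' sigma : R) :
  holomorphic_C0 phi -> (forall s, 0 < Re s -> 0 < Re (phi s)) ->
  (exists s1 s2, 0 < Re s1 /\ 0 < Re s2 /\ phi s1 <> phi s2) ->
  in_Aplus_on_C0 (fun s => npow_neg 2 (phi s)) ->
  0 < sigma -> (forall s, sigma <= Re s -> Cmod (phi s - c1) <= M' * neg_pow2 (Re s)) ->
  0 < Re c1.
Proof.
  intros Hhol Hmaps [s1 [s2 [H1 [H2 H12]]]] [b [Hb Hs]] Hsig Has.
  apply Rnot_le_lt; intros Hc1.
  destruct (Aplus_asymptotic_2 b Hb) as [M [HM HA]].
  assert (L := ln2_lt_ln3).
  assert (B1 : 1 - Cmod (b 1%nat) <= 0).
  { apply (le_pow2_nonpos _ (ln 2 * M' + Cmod (b 2%nat) + M) sigma).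
    intros x Hx. set (s := RtoC x).
    assert (Hr : Re s = x) by reflexivity.
    assert (E := Has s Hx). rewrite Hr in E.
    assert (A := HA s _ ltac:(rewrite Hr; lra) (Hs s ltac:(rewrite Hr; lra))).
    fold (neg_pow3 (Re s)) in A. rewrite Hr in A.
    assert (P32 := neg_pow3_le_pow2 x ltac:(lra)).
    assert (Hre : Re (phi s) <= Cmod (phi s - c1)).
    { assert (K := re_le_Cmod (phi s - c1)).
      replace (Re (phi s - c1)) with (Re (phi s) - Re c1) in K
        by (destruct (phi s), c1; reflexivity).
      apply Rabs_le_between in K. lra. }
    assert (Hlow : 1 - ln 2 * Re (phi s) <= Cmod (npow_neg 2 (phi s))).
    { rewrite Cmod_npow_neg_2. unfold neg_pow2.
      replace (- ln 2 * Re (phi s)) with (- (ln 2 * Re (phi s))) by ring.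
      apply exp_ge_1_minus. }
    assert (T := Cmod_le_minus (npow_neg 2 (phi s)) (b 1%nat + b 2%nat * npow_neg 2 s)).
    assert (T2 := Cmod_triangle (b 1%nat) (b 2%nat * npow_neg 2 s)).
    rewrite Cmod_mult, Cmod_npow_neg_2, Hr in T2.
    assert (ln 2 * Re (phi s) <= ln 2 * (M' * neg_pow2 x)) by (apply Rmult_le_compat_l; lra).
    assert (M * neg_pow3 x <= M * neg_pow2 x) by (apply Rmult_le_compat_l; auto).
    lra. }
  assert (Bm : forall m, (1 < m)%nat -> b m = 0%C).
  { intros m Hm. apply Cmod_le_0.
    assert (K : Cmod (b 1%nat) + Cmod (b m) / 2 <= 1); [|lra].
    apply (bounded_halfplane_coefficients b _ 1 m Hb Hs); try lia.
    intros s Hsp. apply Cmod_npow_neg_le_1. left; auto. }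
  apply H12. apply (constant_of_npow_neg phi (b 1%nat) Hhol); auto.
  intros s Hsp. apply (is_series_C_unique _ _ _ (Hs s Hsp)).
  apply (is_series_C_ext (fun k => if Nat.eqb k 1 then b 1%nat else RtoC 0));
    [|apply is_series_C_single].
  intros [|[|n]]; [reflexivity| |].
  - cbn [dterm]. rewrite npow_neg_1. symmetry. apply Cmult_1_r.
  - cbn [dterm]. rewrite (Bm (S (S n))) by lia. symmetry. apply Cmult_0_l.
Qed.

(* Near its limit [c1], [phi - c1 = c2 2^(-s) + O(3^(-s))], so a function that is
   differentiable at [c1] can produce [3^(-s)] only if it has nonzero derivative,
   hence a nonzero [2^(-s)] term. *)
Lemma c0_zero_absurd (phi : C -> C) (c1 c2 : C) (M sigma : R) :
  holomorphic_C0 phi -> (forall s, 0 < Re s -> 0 < Re (phi s)) ->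
  (exists s1 s2, 0 < Re s1 /\ 0 < Re s2 /\ phi s1 <> phi s2) ->
  in_Aplus_on_C0 (fun s => npow_neg 2 (phi s)) ->
  0 <= M -> 0 < sigma ->
  (forall s, sigma <= Re s ->
     Cmod (phi s - (c1 + c2 * npow_neg 2 s)) <= M * neg_pow3 (Re s)) ->
  Cphi_bijective phi -> False.
Proof.
  intros Hhol Hmaps Hnc Hcomp HM Hsig Has [_ Hsurj].
  set (M' := Cmod c2 + M).
  assert (HM' : 0 <= M') by (unfold M'; generalize (Cmod_ge_0 c2); lra).
  assert (HE : forall s, sigma <= Re s -> Cmod (phi s - c1) <= M' * neg_pow2 (Re s)).
  { intros s Hs. assert (A := Has s Hs).
    assert (T := Cmod_le_minus (phi s - c1) (c2 * npow_neg 2 s)).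
    replace (phi s - c1 - c2 * npow_neg 2 s)%C
      with (phi s - (c1 + c2 * npow_neg 2 s))%C in T by ring.
    rewrite Cmod_mult, Cmod_npow_neg_2 in T.
    assert (P32 := neg_pow3_le_pow2 (Re s) ltac:(lra)).
    assert (M * neg_pow3 (Re s) <= M * neg_pow2 (Re s)) by (apply Rmult_le_compat_l; auto).
    unfold M'. lra. }
  assert (Hc1 := limit_in_C0 phi c1 M' sigma Hhol Hmaps Hnc Hcomp Hsig HE).
  (* Beyond [sigma'] the values of [phi] lie in the disc around [c1] where [Aplus_taylor]
     applies. *)
  assert (Hnear : exists sigma', sigma <= sigma' /\
            forall x, sigma' <= x -> M' * neg_pow2 x <= Re c1 / 2).
  { assert (L := ln2_lt_ln3).
    set (y := (M' / (Re c1 / 2)) / ln 2).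
    exists (Rmax sigma y); split; [apply Rmax_l|].
    intros x Hx. assert (Hxy : y <= x) by (eapply Rle_trans; [apply Rmax_r | exact Hx]).
    assert (Hx0 : 0 <= ln 2 * x).
    { assert (sigma <= x) by (eapply Rle_trans; [apply Rmax_l | exact Hx]). nra. }
    unfold neg_pow2. replace (- ln 2 * x) with (- (ln 2 * x)) by ring. rewrite exp_Ropp.
    assert (E := exp_ineq1_le (ln 2 * x)).
    apply Rle_div_l; [apply exp_pos|].
    assert (M' = (ln 2 * y) * (Re c1 / 2)) by (unfold y; field; lra).
    rewrite Rmult_comm.
    assert (ln 2 * y <= ln 2 * x) by (apply Rmult_le_compat_l; lra).
    nra. }
  destruct Hnear as [sigma' [Hss' Hnear]].
  (* Taylor expansion of the preimage of [p^(-s)], used for [p = 2] and [p = 3]. Its constant term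
     [f c1] is the limit of [p^(-x)] and hence 0. *)
  assert (HF : forall p, (0 < p)%nat ->
     (forall x, 0 <= x -> Cmod (npow_neg p (RtoC x)) <= neg_pow2 x) ->
     exists (D : C) (N : R), 0 <= N /\ forall x, sigma' <= x ->
       Cmod (npow_neg p (RtoC x) - D * (phi (RtoC x) - c1)) <= N * (neg_pow2 x * neg_pow2 x)).
  { intros p Hp Hp2.
    destruct (Hsurj _ (in_Aplus_npow_neg p Hp)) as [f [Hf Hfphi]].
    destruct (Aplus_taylor f c1 Hf Hc1) as [D [K [HK HT]]].
    assert (T0 : forall x, sigma' <= x ->
      Cmod (npow_neg p (RtoC x) - f c1 - D * (phi (RtoC x) - c1))
        <= K * M' * M' * (neg_pow2 x * neg_pow2 x)).
    { intros x Hx. rewrite <- Hfphi by (simpl; lra).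
      assert (E : Cmod (phi (RtoC x) - c1) <= M' * neg_pow2 x)
        by (apply (HE (RtoC x)); simpl; lra).
      eapply Rle_trans; [apply HT; specialize (Hnear x Hx); lra|].
      replace (K * M' * M' * (neg_pow2 x * neg_pow2 x))
        with (K * ((M' * neg_pow2 x) * (M' * neg_pow2 x))) by ring.
      apply Rmult_le_compat_l; auto. apply Rmult_le_compat; auto; apply Cmod_ge_0. }
    assert (Hf0 : f c1 = 0%C).
    { apply Cmod_le_0.
      apply (le_pow2_nonpos _ (1 + Cmod D * M' + K * M' * M') sigma').
      intros x Hx. specialize (T0 x Hx). specialize (Hp2 x ltac:(lra)).
      assert (E : Cmod (phi (RtoC x) - c1) <= M' * neg_pow2 x)
        by (apply (HE (RtoC x)); simpl; lra).
      assert (X1 := neg_pow2_le_1 x ltac:(lra)). assert (X0 := neg_pow2_pos x).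
      assert (Q : Cmod (f c1) <= Cmod (npow_neg p (RtoC x))
         + (Cmod D * (M' * neg_pow2 x) + K * M' * M' * (neg_pow2 x * neg_pow2 x))).
      { replace (f c1) with (npow_neg p (RtoC x) + - (D * (phi (RtoC x) - c1)
           + (npow_neg p (RtoC x) - f c1 - D * (phi (RtoC x) - c1))))%C by ring.
        eapply Rle_trans; [apply Cmod_triangle|]. rewrite Cmod_opp.
        apply Rplus_le_compat_l.
        eapply Rle_trans; [apply Cmod_triangle|]. apply Rplus_le_compat; auto.
        rewrite Cmod_mult. apply Rmult_le_compat_l; auto. apply Cmod_ge_0. }
      assert (0 <= K * M' * M') by (repeat apply Rmult_le_pos; auto).
      assert (K * M' * M' * (neg_pow2 x * neg_pow2 x) <= K * M' * M' * neg_pow2 x)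
        by (apply Rmult_le_compat_l; nra).
      lra. }
    exists D, (K * M' * M'); split; [repeat apply Rmult_le_pos; auto|].
    intros x Hx. specialize (T0 x Hx). rewrite Hf0 in T0.
    replace (npow_neg p x - D * (phi x - c1))%C
      with (npow_neg p x - 0 - D * (phi x - c1))%C by ring. exact T0. }
  destruct (HF 2%nat) as [D2 [N2 [HN2 T2]]]; [lia| |].
  { intros x Hx. rewrite Cmod_npow_neg_2. simpl; lra. }
  destruct (HF 3%nat) as [D3 [N3 [HN3 T3]]]; [lia| |].
  { intros x Hx. rewrite Cmod_npow_neg_3. apply neg_pow3_le_pow2; auto. }
  assert (HcX : forall x, sigma' <= x ->
     Cmod (c2 * npow_neg 2 (RtoC x) - (phi (RtoC x) - c1)) <= M * neg_pow3 x).
  { intros x Hx. rewrite Cmod_minus_sym.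
    replace (phi x - c1 - c2 * npow_neg 2 x)%C
      with (phi x - (c1 + c2 * npow_neg 2 x))%C by ring.
    apply (Has (RtoC x)). simpl; lra. }
  (* With [c2 = 0], [phi - c1] would be [O(3^(-x))], too small to produce [2^(-x)]. *)
  assert (Hc2 : c2 <> 0%C).
  { intros Hc2. assert (1 <= 0); [|lra].
    apply (neg_pow2_le_pow3_nonpos 1 (Cmod D2 * M + N2) sigma').
    intros x Hx. specialize (T2 x Hx). specialize (HcX x Hx).
    assert (S2 := neg_pow2_sqr_le_pow3 x ltac:(lra)).
    assert (Q := Cmod_le_minus (npow_neg 2 (RtoC x)) (D2 * (phi (RtoC x) - c1))).
    rewrite Cmod_npow_neg_2, Cmod_mult in Q. simpl Re in Q.
    rewrite Hc2, Cmod_minus_sym in HcX.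
    replace (phi x - c1 - 0 * npow_neg 2 x)%C with (phi x - c1)%C in HcX by ring.
    assert (Cmod D2 * Cmod (phi x - c1) <= Cmod D2 * (M * neg_pow3 x))
      by (apply Rmult_le_compat_l; [apply Cmod_ge_0 | auto]).
    assert (N2 * (neg_pow2 x * neg_pow2 x) <= N2 * neg_pow3 x) by (apply Rmult_le_compat_l; auto).
    lra. }
  apply Cmod_gt_0 in Hc2.
  assert (HD3 : D3 = 0%C).
  { apply Cmod_le_0.
    assert (Z : Cmod D3 * Cmod c2 <= 0).
    { apply (neg_pow2_le_pow3_nonpos _ (1 + N3 + Cmod D3 * M) sigma').
      intros x Hx. specialize (T3 x Hx). specialize (HcX x Hx).
      assert (S2 := neg_pow2_sqr_le_pow3 x ltac:(lra)).
      assert (Q1 := Cmod_le_minus (c2 * npow_neg 2 (RtoC x)) (phi (RtoC x) - c1)).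
      rewrite Cmod_mult, Cmod_npow_neg_2 in Q1. simpl Re in Q1.
      assert (Q2 := Cmod_le_minus (D3 * (phi (RtoC x) - c1)) (npow_neg 3 (RtoC x))).
      rewrite Cmod_minus_sym, Cmod_mult, Cmod_npow_neg_3 in Q2. simpl Re in Q2.
      assert (Cmod D3 * (Cmod c2 * neg_pow2 x)
         <= Cmod D3 * (Cmod (phi x - c1) + M * neg_pow3 x))
        by (apply Rmult_le_compat_l; [apply Cmod_ge_0 | lra]).
      assert (N3 * (neg_pow2 x * neg_pow2 x) <= N3 * neg_pow3 x) by (apply Rmult_le_compat_l; auto).
      lra. }
    assert (G := Cmod_ge_0 D3). nra. }
  (* With [D3 = 0] only the quadratic error is left to account for [3^(-x)]. *)
  assert (1 <= 0); [|lra].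
  apply (neg_pow3_le_pow2_sqr_nonpos 1 N3 sigma').
  intros x Hx. specialize (T3 x Hx). rewrite HD3 in T3.
  replace (npow_neg 3 x - 0 * (phi x - c1))%C with (npow_neg 3 x) in T3 by ring.
  rewrite Cmod_npow_neg_3 in T3. simpl Re in T3. lra.
Qed.

(** * The case c0 > 0 *)

Lemma neg_pow2_phi_bound (x B r : R) (c0 : nat) :
  (1 <= c0)%nat -> 0 <= x -> INR c0 * x - B <= r ->
  neg_pow2 r <= exp (ln 2 * B) * neg_pow2 (INR c0 * x) /\
  neg_pow3 r <= exp (ln 3 * B) * neg_pow3 (INR c0 * x).
Proof.
  intros Hc Hx Hr. assert (L := ln2_lt_ln3). unfold neg_pow2, neg_pow3.
  rewrite <- !exp_plus. split; apply exp_le_compat; nra.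
Qed.

(** Up to [a_2 b_2 = 1] everything is read off along the real axis as [x] tends to infinity; the
    coefficient inequality then turns this into information on all of C_0. *)
Lemma c0_positive_translation (phi varphi : C -> C) (c0 : nat) (c1 c2 : C) (M sigma : R) :
  (forall s, 0 < Re s -> 0 < Re (phi s)) ->
  (forall s, 0 < Re s -> phi s = (RtoC (INR c0) * s + varphi s)%C) ->
  holomorphic_C0 varphi ->
  in_Aplus_on_C0 (fun s => npow_neg 2 (phi s)) ->
  (1 <= c0)%nat -> 0 <= M -> 0 < sigma ->
  (forall s, sigma <= Re s ->
     Cmod (varphi s - (c1 + c2 * npow_neg 2 s)) <= M * neg_pow3 (Re s)) ->
  Cphi_bijective phi ->
  exists tau : R, forall s, 0 < Re s -> phi s = (s + (0%R, tau))%C.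
Proof.
  intros Hmaps Hform Hhol [b [Hb Hbs]] Hc0 HM Hsig Has Hbij.
  assert (L := ln2_lt_ln3).
  destruct (proj2 Hbij _ (in_Aplus_npow_neg 2 ltac:(lia))) as [f [Hf Hfphi]].
  assert (Hf1 := preimage_bound phi f Hbij Hmaps Hf Hfphi).
  destruct Hf as [a [Ha Hfa]].
  destruct (Aplus_asymptotic_2 a Ha) as [Ma [HMa HA]].
  destruct (Aplus_asymptotic_2 b Hb) as [Mb [HMb HB]].
  set (B := Cmod c1 + Cmod c2 + M).
  assert (HBre : forall x, sigma <= x -> INR c0 * x - B <= Re (phi (RtoC x))).
  { intros x Hx. rewrite Hform by (simpl; lra).
    assert (A := Has (RtoC x) Hx). simpl Re in A.
    assert (T := Cmod_le_minus (varphi (RtoC x)) (c1 + c2 * npow_neg 2 (RtoC x))).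
    assert (T2 := Cmod_triangle c1 (c2 * npow_neg 2 (RtoC x))).
    rewrite Cmod_mult, Cmod_npow_neg_2 in T2. simpl Re in T2.
    assert (X1 := neg_pow2_le_1 x ltac:(lra)). assert (X3 := neg_pow3_le_pow2 x ltac:(lra)).
    assert (Cmod c2 * neg_pow2 x <= Cmod c2 * 1) by (apply Rmult_le_compat_l; [apply Cmod_ge_0|auto]).
    assert (M * neg_pow3 x <= M * 1) by (apply Rmult_le_compat_l; lra).
    assert (R1 := re_le_Cmod (varphi (RtoC x))). apply Rabs_le_between in R1.
    replace (Re (RtoC (INR c0) * RtoC x + varphi (RtoC x)))
      with (INR c0 * x + Re (varphi (RtoC x))) by (unfold Re; simpl; ring).
    unfold B. lra. }
  set (K2 := exp (ln 2 * B)). set (K3 := exp (ln 3 * B)).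
  assert (PK2 : 0 < K2) by apply exp_pos. assert (PK3 : 0 < K3) by apply exp_pos.
  assert (Hphi2 : forall x, sigma <= x ->
      neg_pow2 (Re (phi (RtoC x))) <= K2 * neg_pow2 (INR c0 * x) /\
      neg_pow3 (Re (phi (RtoC x))) <= K3 * neg_pow3 (INR c0 * x)).
  { intros x Hx. apply neg_pow2_phi_bound; auto; lra. }
  assert (HfA : forall x, sigma <= x ->
     Cmod (npow_neg 2 (RtoC x) - (a 1%nat + a 2%nat * npow_neg 2 (phi (RtoC x))))
       <= Ma * K3 * neg_pow3 (INR c0 * x)).
  { intros x Hx. rewrite <- Hfphi by (simpl; lra).
    assert (Hp := Hmaps (RtoC x) ltac:(simpl; lra)).
    eapply Rle_trans; [apply (HA (phi (RtoC x))); [lra | apply Hfa; lra]|].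
    rewrite Rmult_assoc. apply Rmult_le_compat_l; auto. apply Hphi2; auto. }
  assert (Hc0R : 1 <= INR c0) by (replace 1 with (INR 1) by reflexivity; apply le_INR; auto).
  assert (Ga := Cmod_ge_0 (a 2%nat)). assert (Gb := Cmod_ge_0 (b 2%nat)).
  assert (Ha1 : a 1%nat = 0%C).
  { apply Cmod_le_0.
    apply (le_pow2_nonpos _ (1 + Cmod (a 2%nat) * K2 + Ma * K3) sigma).
    intros x Hx. assert (E := HfA x Hx). destruct (Hphi2 x Hx) as [E2 _].
    assert (m2 := neg_pow2_mul_le x (INR c0) ltac:(lra) Hc0R).
    assert (m3 := neg_pow3_mul_le x (INR c0) ltac:(lra) Hc0R).
    assert (m32 := neg_pow3_le_pow2 x ltac:(lra)).
    assert (Q : Cmod (a 1%nat) <= neg_pow2 x + (Cmod (a 2%nat) * neg_pow2 (Re (phi (RtoC x)))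
        + Ma * K3 * neg_pow3 (INR c0 * x))).
    { replace (a 1%nat) with (npow_neg 2 (RtoC x) + - (a 2%nat * npow_neg 2 (phi (RtoC x)) +
        (npow_neg 2 (RtoC x) - (a 1%nat + a 2%nat * npow_neg 2 (phi (RtoC x))))))%C by ring.
      eapply Rle_trans; [apply Cmod_triangle|]. rewrite Cmod_opp, Cmod_npow_neg_2.
      simpl (Re (RtoC x)). apply Rplus_le_compat_l.
      eapply Rle_trans; [apply Cmod_triangle|]. apply Rplus_le_compat; auto.
      rewrite Cmod_mult, Cmod_npow_neg_2. lra. }
    assert (Cmod (a 2%nat) * neg_pow2 (Re (phi (RtoC x))) <= Cmod (a 2%nat) * (K2 * neg_pow2 x)).
    { apply Rmult_le_compat_l; auto. eapply Rle_trans; [exact E2|].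
      apply Rmult_le_compat_l; lra. }
    assert (Ma * K3 * neg_pow3 (INR c0 * x) <= Ma * K3 * neg_pow2 x)
      by (apply Rmult_le_compat_l; [apply Rmult_le_pos|]; lra).
    lra. }
  (* For [c0 >= 2] the whole of [f (phi x)] would be [O(3^(-x))], yet it equals [2^(-x)]. *)
  assert (Hc01 : c0 = 1%nat).
  { destruct (Nat.eq_dec c0 1) as [|Hne]; auto. exfalso.
    assert (Hc2R : 2 <= INR c0) by (replace 2 with (INR 2) by (simpl; ring); apply le_INR; lia).
    assert (1 <= 0); [|lra].
    apply (neg_pow2_le_pow3_nonpos 1 (Cmod (a 2%nat) * K2 + Ma * K3) sigma).
    intros x Hx. assert (E := HfA x Hx). destruct (Hphi2 x Hx) as [E2 _].
    rewrite Ha1 in E.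
    replace (0 + a 2%nat * npow_neg 2 (phi (RtoC x)))%C
      with (a 2%nat * npow_neg 2 (phi (RtoC x)))%C in E by ring.
    assert (Q := Cmod_le_minus (npow_neg 2 (RtoC x)) (a 2%nat * npow_neg 2 (phi (RtoC x)))).
    rewrite Cmod_mult, !Cmod_npow_neg_2 in Q. simpl (Re (RtoC x)) in Q.
    assert (m3 := neg_pow3_mul_le x (INR c0) ltac:(lra) Hc0R).
    assert (m2 : neg_pow2 (INR c0 * x) <= neg_pow3 x).
    { eapply Rle_trans; [|apply neg_pow2_sqr_le_pow3; lra]. unfold neg_pow2.
      rewrite <- exp_plus. apply exp_le_compat.
      assert (2 * x <= INR c0 * x) by (apply Rmult_le_compat_r; lra). nra. }
    assert (Cmod (a 2%nat) * neg_pow2 (Re (phi (RtoC x))) <= Cmod (a 2%nat) * (K2 * neg_pow3 x)).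
    { apply Rmult_le_compat_l; auto. eapply Rle_trans; [exact E2|].
      apply Rmult_le_compat_l; lra. }
    assert (Ma * K3 * neg_pow3 (INR c0 * x) <= Ma * K3 * neg_pow3 x)
      by (apply Rmult_le_compat_l; [apply Rmult_le_pos|]; lra).
    lra. }
  subst c0. simpl INR in *.
  assert (HbA : forall x, sigma <= x ->
     Cmod (npow_neg 2 (phi (RtoC x)) - (b 1%nat + b 2%nat * npow_neg 2 (RtoC x)))
       <= Mb * neg_pow3 x).
  { intros x Hx. apply (HB (RtoC x)); [simpl; lra | apply Hbs; simpl; lra]. }
  assert (Hb1 : b 1%nat = 0%C).
  { apply Cmod_le_0.
    apply (le_pow2_nonpos _ (K2 + Cmod (b 2%nat) + Mb) sigma).
    intros x Hx. assert (E := HbA x Hx). destruct (Hphi2 x Hx) as [E2 _].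
    rewrite Rmult_1_l in E2.
    assert (m32 := neg_pow3_le_pow2 x ltac:(lra)).
    assert (Q : Cmod (b 1%nat) <= neg_pow2 (Re (phi (RtoC x))) +
       (Cmod (b 2%nat) * neg_pow2 x + Mb * neg_pow3 x)).
    { replace (b 1%nat) with (npow_neg 2 (phi (RtoC x)) + - (b 2%nat * npow_neg 2 (RtoC x) +
        (npow_neg 2 (phi (RtoC x)) - (b 1%nat + b 2%nat * npow_neg 2 (RtoC x)))))%C by ring.
      eapply Rle_trans; [apply Cmod_triangle|]. rewrite Cmod_opp, Cmod_npow_neg_2.
      apply Rplus_le_compat_l.
      eapply Rle_trans; [apply Cmod_triangle|]. apply Rplus_le_compat; auto.
      rewrite Cmod_mult, Cmod_npow_neg_2. simpl; lra. }
    assert (Mb * neg_pow3 x <= Mb * neg_pow2 x) by (apply Rmult_le_compat_l; lra).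
    lra. }
  assert (Hab : (1 - a 2%nat * b 2%nat)%C = 0%C).
  { apply Cmod_le_0.
    apply (neg_pow2_le_pow3_nonpos _ (Ma * K3 + Cmod (a 2%nat) * Mb) sigma).
    intros x Hx. assert (E1 := HfA x Hx). assert (E2 := HbA x Hx).
    rewrite Rmult_1_l, Ha1 in E1. rewrite Hb1 in E2.
    replace (neg_pow2 x) with (Cmod (npow_neg 2 (RtoC x))) by apply Cmod_npow_neg_2.
    rewrite <- Cmod_mult.
    replace ((1 - a 2%nat * b 2%nat) * npow_neg 2 (RtoC x))%C with
      ((npow_neg 2 (RtoC x) - (0 + a 2%nat * npow_neg 2 (phi (RtoC x)))) +
       a 2%nat * (npow_neg 2 (phi (RtoC x)) - (0 + b 2%nat * npow_neg 2 (RtoC x))))%C by ring.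
    eapply Rle_trans; [apply Cmod_triangle|]. rewrite Cmod_mult.
    assert (Cmod (a 2%nat) * Cmod (npow_neg 2 (phi (RtoC x)) - (0 + b 2%nat * npow_neg 2 (RtoC x)))
      <= Cmod (a 2%nat) * (Mb * neg_pow3 x)) by (apply Rmult_le_compat_l; auto).
    lra. }
  (* The choice [m = 3] makes the condition on the index [n0^2/m] vacuous, as 3 does not divide
     4. *)
  assert (Ka : Cmod (a 2%nat) <= 1).
  { assert (K : Cmod (a 2%nat) + Cmod (a 3%nat) / 2 <= 1).
    { apply (bounded_halfplane_coefficients a f 2 3 Ha); try lia.
      - intros s Hs. apply Hfa; lra.
      - intros s Hs. apply Hf1; lra. }
    assert (G := Cmod_ge_0 (a 3%nat)). lra. }
  assert (Kb : forall m, (2 < m)%nat -> Cmod (b 2%nat) + Cmod (b m) / 2 <= 1).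
  { intros m Hm. apply (bounded_halfplane_coefficients b _ 2 m Hb Hbs); try lia.
    - intros s Hs. apply Cmod_npow_neg_le_1. left; auto.
    - intros n Hn Hnm. assert (n = 1%nat) by nia. subst n. exact Hb1. }
  assert (Hb2 : Cmod (b 2%nat) = 1).
  { assert (K3' := Kb 3%nat ltac:(lia)). assert (G := Cmod_ge_0 (b 3%nat)).
    assert (E : Cmod (a 2%nat) * Cmod (b 2%nat) = 1).
    { rewrite <- Cmod_mult, <- Cmod_1. f_equal.
      replace (a 2%nat * b 2%nat)%C with (1 - (1 - a 2%nat * b 2%nat))%C by ring.
      rewrite Hab. ring. }
    nra. }
  assert (Hbm : forall m, (2 < m)%nat -> b m = 0%C).
  { intros m Hm. apply Cmod_le_0. specialize (Kb m Hm). lra. }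
  assert (Hk : forall s, 0 < Re s -> npow_neg 2 (varphi s) = b 2%nat).
  { intros s Hs.
    assert (E : npow_neg 2 (phi s) = (b 2%nat * npow_neg 2 s)%C).
    { apply (is_series_C_unique _ _ _ (Hbs s Hs)).
      apply (is_series_C_ext (fun k => if Nat.eqb k 2 then (b 2%nat * npow_neg 2 s)%C else RtoC 0));
        [|apply is_series_C_single].
      intros [|[|[|n]]]; [reflexivity| |reflexivity|].
      - cbn [dterm]. rewrite Hb1. symmetry. apply Cmult_0_l.
      - cbn [dterm]. rewrite (Hbm (S (S (S n)))) by lia. symmetry. apply Cmult_0_l. }
    rewrite Hform, Cmult_1_l, npow_neg_plus in E by auto.
    assert (NZ : npow_neg 2 s <> 0%C) by apply cexp_neq_0.
    replace (npow_neg 2 (varphi s)) with (npow_neg 2 s * npow_neg 2 (varphi s) / npow_neg 2 s)%C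
      by (field; auto).
    rewrite E. field; auto. }
  assert (Hconst := constant_of_npow_neg varphi (b 2%nat) Hhol Hk).
  set (s0 := RtoC 1). assert (Hs0 : 0 < Re s0) by (simpl; lra).
  (* [|2^(-varphi)| = |b_2| = 1] leaves no real part. *)
  assert (Hre0 : Re (varphi s0) = 0).
  { assert (E := Hk s0 Hs0). apply (f_equal Cmod) in E.
    rewrite Cmod_npow_neg_2, Hb2 in E. unfold neg_pow2 in E.
    rewrite <- exp_0 in E. apply exp_inv in E. nra. }
  exists (Im (varphi s0)). intros s Hs. rewrite Hform, Cmult_1_l by auto. f_equal.
  rewrite (Hconst s s0 Hs Hs0), (surjective_pairing (varphi s0)).
  f_equal. exact Hre0.
Qed.

(** * Vertical translations are automorphisms *)

Lemma translation_bijective (phi : C -> C) (tau : R) :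
  (forall s, 0 < Re s -> phi s = (s + (0%R, tau))%C) -> Cphi_bijective phi.
Proof.
  intros Hphi. split.
  - intros f g Hf Hg Hfg s Hs.
    assert (Hop : forall z, 0 < Re z -> f z = g z).
    { intros z Hz. set (z' := (z - (0%R, tau))%C).
      assert (Hz' : 0 < Re z') by (unfold Re, z' in *; simpl; lra).
      assert (E := Hfg z' Hz'). rewrite Hphi in E by auto.
      replace (z' + (0%R, tau))%C with z in E by (unfold z'; ring). exact E. }
    (* The difference [f - g] lies in A^+ and vanishes for [Re s > 0]; right continuity extends this
       to the boundary line. *)
    destruct (in_Aplus_lin 1 (- (1)) f g Hf Hg) as [a [Ha Hh]].
    set (h := fun s => (1 * f s + - (1) * g s)%C) in Hh.
    assert (Z : h s = 0%C).
    { apply Cmod_le_0, Rnot_lt_le. intros Hgt.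
      destruct (dirichlet_right_continuous a s (h s) (Cmod (h s) / 2) Ha Hs (Hh s Hs))
        as [x [Hx Hc]]; [lra|].
      assert (Hsx : 0 < Re (s + RtoC x)).
      { replace (Re (s + RtoC x)) with (Re s + x) by (unfold Re; simpl; ring). lra. }
      specialize (Hc x (h (s + RtoC x)%C) (conj Hx (Rle_refl x)) (Hh _ (Rlt_le _ _ Hsx))).
      unfold h at 1 in Hc. rewrite (Hop _ Hsx) in Hc.
      replace (1 * g (s + x) + - (1) * g (s + x) - h s)%C with (- h s)%C in Hc by ring.
      rewrite Cmod_opp in Hc. lra. }
    replace (f s) with (h s + g s)%C by (unfold h; ring). rewrite Z. ring.
  - intros g [a [Ha Hg]]. exists (fun s => g (s - (0%R, tau))%C). split.
    (* Translating back multiplies the coefficients by the unimodular numbers [n^(i tau)], which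
       preserves summability. *)
    + exists (fun n => a n * npow_neg n (- (0%R, tau)))%C. split.
      * apply (ex_series_ext (coef_abs a)); [|exact Ha].
        intros [|n]; [reflexivity|]. simpl coef_abs.
        rewrite Cmod_mult, Cmod_npow_neg. simpl Re.
        replace (- ln (INR (S n)) * - 0) with 0 by ring. rewrite exp_0, Rmult_1_r. reflexivity.
      * intros s Hs.
        apply (is_series_C_ext (dterm a (s - (0%R, tau))%C)).
        -- intros [|n]; [reflexivity|]. cbn [dterm].
           unfold Cminus. rewrite npow_neg_plus. ring.
        -- apply Hg. unfold Re in *; simpl; lra.
    + intros s Hs. rewrite Hphi by auto. f_equal. ring.
Qed.

Theorem theorem15 (phi : C -> C) (c0 : nat) (varphi : C -> C)
  (Hhol : holomorphic_C0 phi)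
  (Hmaps : forall s : C, 0 < Re s -> 0 < Re (phi s))
  (Hnonconst : exists s1 s2 : C, 0 < Re s1 /\ 0 < Re s2 /\ phi s1 <> phi s2)
  (Hform : forall s : C, 0 < Re s -> phi s = Cplus (Cmult (RtoC (INR c0)) s) (varphi s))
  (HD : in_D varphi)
  (Hcomp : forall f : C -> C, in_Aplus f -> in_Aplus_on_C0 (fun s => f (phi s))) :
  Cphi_bijective phi <->
  exists tau : R, forall s : C, 0 < Re s -> phi s = Cplus s ((0%R, tau) : C).
Proof.
  split.
  - intros Hbij.
    destruct (in_D_asymptotic varphi HD) as [c1 [c2 [M [sigma [HM [Hsig Has]]]]]].
    assert (H2 := Hcomp _ (in_Aplus_npow_neg 2 ltac:(lia))).
    destruct c0 as [|c0].
    + exfalso.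
      apply (c0_zero_absurd phi c1 c2 M sigma Hhol Hmaps Hnonconst H2 HM Hsig); auto.
      intros s Hs. rewrite Hform by lra. simpl INR.
      replace (0 * s + varphi s)%C with (varphi s) by ring. apply Has; auto.
    + apply (c0_positive_translation phi varphi (S c0) c1 c2 M sigma Hmaps Hform (proj1 HD) H2);
        auto. lia.
  - intros [tau Htau]. apply (translation_bijective phi tau Htau).
Qed.
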